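(* Let $U=M_\xi$ be multiplication by the independent variable on the direct integral $\mathcal H\subset L^2(\mu;E)$, let $\mathbf B:\mathbb C^d\to\mathcal H$ be an isometry, let $\Gamma$ be a strict contraction on $\mathbb C^d$, and for a strict contraction $\Gamma'$ on $\mathbb C^d$ let $\theta_{\Gamma'}$ be the characteristic function of $T_{\Gamma'}=U+\mathbf B(\Gamma'-\mathbf I)\mathbf B^*U$ with coordinate operators $V=\mathbf B^*U$, $V_*=\mathbf B^*$, and let $\Delta_{\Gamma'}=(\mathbf I-\theta_{\Gamma'}^*\theta_{\Gamma'})^{1/2}$ be its defect function on $\mathbb T$. Then, a.e. on $\mathbb T$, $$\Delta_\Gamma^2=D_\Gamma(\mathbf I-\theta_{\mathbf 0}^*\Gamma)^{-1}\Delta_{\mathbf 0}^2(\mathbf I-\Gamma^*\theta_{\mathbf 0})^{-1}D_\Gamma .$$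
   Context: Direct integral: $\mu$ is a finite positive Borel measure on the unit circle $\mathbb T$; $E$ is a separable Hilbert space with orthonormal basis $(\varepsilon_n)_{n\ge1}$; $N:\mathbb T\to\mathbb N\cup\{\infty\}$ is measurable; $E(\xi)=\overline{\operatorname{span}}\{\varepsilon_n:1\le n\le N(\xi)\}$; $\mathcal H=\{f\in L^2(\mu;E): f(\xi)\in E(\xi)\ \mu\text{-a.e.}\}$. Strict contraction: $\|\Gamma x\|<\|x\|$ for all $x\ne0$. For a contraction $A$: $D_A=(\mathbf I-A^*A)^{1/2}$, $D_{A^*}=(\mathbf I-AA^* )^{1/2}$, $\mathfrak D_A=\operatorname{clos}\operatorname{Ran}D_A$. For $T=T_{\Gamma'}$ one has $\mathfrak D_T=U^*\operatorname{Ran}\mathbf B$, $\mathfrak D_{T^*}=\operatorname{Ran}\mathbf B$, so $V=\mathbf B^*U:\mathfrak D_T\to\mathbb C^d$ and $V_*=\mathbf B^*:\mathfrak D_{T^*}\to\mathbb C^d$ are unitary. The characteristic function of $T$ with these coordinate operators is the $d\times d$ matrix-valued bounded analytic function $\theta_T(z)=V_*\bigl(-T+zD_{T^*}(\mathbf I-zT^* )^{-1}D_T\bigr)V^*$, $z\in\mathbb D$; it satisfies $\|\theta_T\|_\infty\le1$, and the same symbol denotes its non-tangential boundary values a.e. on $\mathbb T$. *)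

(* Defs.v *)
From HB Require Import structures.
From mathcomp Require Import all_boot all_order all_algebra.
From mathcomp Require Import sesquilinear spectral generic_quotient complex.
From mathcomp Require Import all_classical all_reals all_analysis.
From mathcomp Require Import measurable_realfun.
From mathcomp Require Import ring lra.

Set Implicit Arguments.
Unset Strict Implicit.
Unset Printing Implicit Defensive.

Import Order.TTheory GRing.Theory Num.Theory.
Import numFieldNormedType.Exports.

Local Open Scope classical_set_scope.
Local Open Scope complex_scope.
Local Open Scope ring_scope.

Local Notation Re := complex.Re.
Local Notation Im := complex.Im.


(* The inner product is linear in the first argument and conjugate-linear in
   the second one. *)
HB.mixin Record isPreHilbert (R : realType) U of GRing.Lmodule R[i] U := {
  hdot : U -> U -> R[i];
  hdot_linear : forall y, scalar (hdot ^~ y);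
  hdot_conj : forall x y, hdot x y = Num.conj (hdot y x);
  hdot_gt0 : forall x, x != 0 -> 0 < hdot x x
}.

#[short(type="preHilbertType")]
HB.structure Definition PreHilbert (R : realType) :=
  {U of GRing.Lmodule R[i] U & isPreHilbert R U}.

Notation "''[' x , y ]" := (hdot x y) (format "''[' x ,  y ]") : ring_scope.

Section PreHilbertDot.
Variables (R : realType) (U : preHilbertType R).

Lemma hdot_bilinear : bilinear_for
  (GRing.Scale.Law.clone _ _ *%R _)
  (GRing.Scale.Law.clone _ _ (@Num.conj R[i] \; *%R) _) (@hdot R U).
Proof.
split => [y|x] a u v /=; first exact: hdot_linear.
by rewrite (hdot_conj x u) (hdot_conj x v) hdot_conj hdot_linear rmorphD rmorphM.
Qed.

HB.instance Definition _ := bilinear_isBilinear.Build R[i] U U R[i]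
  *%R (@Num.conj R[i] \; *%R) (@hdot R U) hdot_bilinear.

Lemma hdot_hermitian (x y : U) :
  '[x, y] = (-1) ^+ false * Num.conj '[y, x].
Proof. by rewrite expr0 mul1r hdot_conj. Qed.

HB.instance Definition _ := isHermitianSesquilinear.Build R[i] U
  false (@Num.conj R[i]) (@hdot R U) hdot_hermitian.

HB.instance Definition _ := isDotProduct.Build R[i] U (@hdot R U) hdot_gt0.

End PreHilbertDot.

Section PreHilbertTheory.
Variables (R : realType) (U : preHilbertType R).
Implicit Types (x y z : U) (a : R[i]).

Definition hnorm x : R := Num.sqrt (Re '[x, x]).

Lemma ReD (u v : R[i]) : Re (u + v) = Re u + Re v.
Proof. by case: u; case: v. Qed.

Lemma ImD (u v : R[i]) : Im (u + v) = Im u + Im v.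
Proof. by case: u; case: v. Qed.

Lemma conjRe (u : R[i]) : Re (Num.conj u) = Re u.
Proof. by case: u. Qed.

Lemma conjIm (u : R[i]) : Im (Num.conj u) = - Im u.
Proof. by case: u. Qed.

Lemma hdotDl x y z : '[x + y, z] = '[x, z] + '[y, z].
Proof. by rewrite linearDl. Qed.

Lemma hdotDr x y z : '[z, x + y] = '[z, x] + '[z, y].
Proof. by rewrite linearDr. Qed.

Lemma hdotZl a x z : '[a *: x, z] = a * '[x, z].
Proof. by rewrite linearZl_LR. Qed.

Lemma hdotZr a x z : '[z, a *: x] = Num.conj a * '[z, x].
Proof. by rewrite linearZr_LR. Qed.

Lemma hdot_suml (I : Type) (s : seq I) (F : I -> U) z :
  '[\sum_(i <- s) F i, z] = \sum_(i <- s) '[F i, z].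
Proof.
elim/big_rec2 : _ => [|i u v _ <-]; last by rewrite hdotDl.
by rewrite linear0l.
Qed.

Lemma Re_hdotC x y : Re '[y, x] = Re '[x, y].
Proof. by rewrite hdot_conj conjRe. Qed.

Lemma hnorm_sqr x : hnorm x ^+ 2 = Re '[x, x].
Proof.
rewrite sqr_sqrtr//; have := dnorm_ge0 (@hdot R U) x.
by rewrite lecE => /andP[].
Qed.

Lemma hdot_self x : '[x, x] = (hnorm x ^+ 2)%:C.
Proof.
rewrite hnorm_sqr; have := dnorm_ge0 (@hdot R U) x.
by rewrite lecE => /andP[/eqP/=]; case: '[x, x] => a b /= ->.
Qed.

Lemma hnorm_sqrD x y :
  hnorm (x + y) ^+ 2 = hnorm x ^+ 2 + hnorm y ^+ 2 + 2 * Re '[x, y].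
Proof.
by rewrite !hnorm_sqr hdotDl !hdotDr !ReD (Re_hdotC x y); lra.
Qed.

Lemma hnorm_sqrZ a x :
  hnorm (a *: x) ^+ 2 = (Re a ^+ 2 + Im a ^+ 2) * hnorm x ^+ 2.
Proof.
rewrite hnorm_sqr hdotZl hdotZr mulrA hdot_self.
by case: a => s t /=; rewrite !(mulr0, mulrN, opprK, subr0, mulr0).
Qed.

Lemma hnorm_opp x : hnorm (- x) = hnorm x.
Proof. by rewrite /hnorm linearNl linearNr opprK. Qed.

Lemma hnorm_ge0 x : 0 <= hnorm x.
Proof. exact: sqrtr_ge0. Qed.

Lemma Re_hdot_le x y : `|Re '[x, y]| <= hnorm x ^+ 2 + hnorm y ^+ 2.
Proof.
have h1 := sqr_ge0 (hnorm (x + y)); have h2 := sqr_ge0 (hnorm (x - y)).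
rewrite hnorm_sqrD in h1; rewrite hnorm_sqrD hnorm_opp linearNr in h2.
have E : Re (- '[x, y]) = - Re '[x, y] by case: '[x, y].
rewrite E in h2.
have := sqr_ge0 (hnorm x); have := sqr_ge0 (hnorm y).
rewrite ler_norml; move=> *; apply/andP; split; lra.
Qed.

Lemma Im_hdot x y : Im '[x, y] = Re '[x, 'i *: y].
Proof.
rewrite hdotZr; case: '[x, y] => a b /=.
by rewrite mul0r mulN1r opprK add0r.
Qed.

Lemma hnormi x : hnorm ('i *: x) ^+ 2 = hnorm x ^+ 2.
Proof. by rewrite hnorm_sqrZ /= expr0n expr1n add0r mul1r. Qed.

Lemma Im_hdot_le x y : `|Im '[x, y]| <= hnorm x ^+ 2 + hnorm y ^+ 2.
Proof. by rewrite Im_hdot (le_trans (Re_hdot_le _ _))// hnormi. Qed.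

Lemma hnorm_sqrD_le x y :
  hnorm (x + y) ^+ 2 <= 2 * (hnorm x ^+ 2 + hnorm y ^+ 2).
Proof.
have h2 := sqr_ge0 (hnorm (x - y)).
rewrite hnorm_sqrD hnorm_opp linearNr in h2.
have E : Re (- '[x, y]) = - Re '[x, y] by case: '[x, y].
by rewrite hnorm_sqrD; rewrite E in h2; lra.
Qed.

Lemma Re_hdot_polar x y :
  Re '[x, y] = (hnorm (x + y) ^+ 2 - hnorm x ^+ 2 - hnorm y ^+ 2) / 2.
Proof. by rewrite hnorm_sqrD; lra. Qed.

Definition hspan (A : set U) : set U :=
  [set x | exists s : seq (R[i] * U),
     (forall p, p \in s -> A p.2) /\ x = \sum_(p <- s) p.1 *: p.2].

Definition hclosure (A : set U) : set U :=
  [set x | forall e : R, 0 < e -> exists2 y, A y & hnorm (x - y) < e].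

Lemma hspan_lin (A : set U) a x y :
  hspan A x -> hspan A y -> hspan A (a *: x + y).
Proof.
move=> [s [sA ->]] [t [tA ->]].
exists ([seq (a * p.1, p.2) | p <- s] ++ t); split.
  by move=> p; rewrite mem_cat => /orP[/mapP[q qs ->]/=|]; [exact: sA|exact: tA].
rewrite big_cat big_map /= scaler_sumr; congr +%R.
by apply: eq_bigr => p _; rewrite scalerA.
Qed.

Lemma hclosure_span0 (A : set U) : hclosure (hspan A) 0.
Proof.
move=> e e0; exists 0.
  by exists [::]; rewrite big_nil.
by rewrite subr0 /hnorm linear0l /= sqrtr0.
Qed.

Lemma hclosure_span_lin (A : set U) a x y :
  hclosure (hspan A) x -> hclosure (hspan A) y ->
  hclosure (hspan A) (a *: x + y).
Proof.
move=> hx hy e e0.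
pose c : R := Re a ^+ 2 + Im a ^+ 2.
have c0 : 0 <= c by rewrite addr_ge0// sqr_ge0.
pose k : R := 2 * (1 + c).
have k0 : 0 < k by rewrite /k; lra.
have ek : 0 < e / k by rewrite divr_gt0.
have [x' Ax' hx'] := hx _ ek; have [y' Ay' hy'] := hy _ ek.
exists (a *: x' + y'); first exact: hspan_lin.
rewrite -(ltr_pXn2r (ltn0Sn 1)) ?nnegrE ?hnorm_ge0 ?(ltW e0)//.
rewrite opprD addrACA -scalerBr (le_lt_trans (hnorm_sqrD_le _ _))//.
rewrite hnorm_sqrZ -/c.
have X : hnorm (x - x') ^+ 2 < (e / k) ^+ 2.
  by rewrite ltr_pXn2r// nnegrE ?hnorm_ge0// ltW.
have Y : hnorm (y - y') ^+ 2 < (e / k) ^+ 2.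
  by rewrite ltr_pXn2r// nnegrE ?hnorm_ge0// ltW.
have E : e = k * (e / k) by rewrite mulrC divfK// gt_eqF.
rewrite [in ltRHS]E; set r := e / k in X Y *.
have r0 : 0 < r ^+ 2 by rewrite exprn_gt0.
rewrite exprMn.
have H : c * hnorm (x - x') ^+ 2 <= c * r ^+ 2 by rewrite ler_wpM2l// ltW.
have kk : k * r ^+ 2 <= k ^+ 2 * r ^+ 2.
  by rewrite ler_pM2r// expr2 ler_peMr ?(ltW k0)// /k; lra.
apply: lt_le_trans kk; rewrite /k; lra.
Qed.

Definition orthonormal_seq (eps : nat -> U) :=
  forall m n, '[eps m, eps n] = (m == n)%:R.

Definition is_onb (eps : nat -> U) :=
  orthonormal_seq eps /\ hclosure (hspan (range eps)) = setT.

End PreHilbertTheory.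

Record onb (R : realType) (U : preHilbertType R) := Onb {
  onb_fun :> nat -> U;
  onbP : is_onb onb_fun
}.

Section Bessel.
Variables (R : realType) (U : preHilbertType R) (eps : onb U).
Implicit Types x y : U.

Let ps x n := \sum_(k < n) '[x, eps k] *: eps k.

Let ps_dot x n k : (k < n)%N -> '[ps x n, eps k] = '[x, eps k].
Proof.
move=> kn; rewrite hdot_suml (bigD1 (Ordinal kn))//= big1 ?addr0.
  by rewrite hdotZl (onbP eps).1 eqxx mulr1.
move=> i; rewrite -val_eqE /= => /negbTE ik.
by rewrite hdotZl (onbP eps).1 ik mulr0.
Qed.

Let ps_lin n a x y : ps (a *: x + y) n = a *: ps x n + ps y n.
Proof.
rewrite /ps scaler_sumr -big_split; apply: eq_bigr => k _ /=.
by rewrite hdotDl hdotZl scalerDl scalerA.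
Qed.

Let ps_eps n k : (k < n)%N -> ps (eps k) n = eps k.
Proof.
move=> kn; rewrite /ps (bigD1 (Ordinal kn))//= big1 ?addr0.
  by rewrite (onbP eps).1 eqxx scale1r.
move=> i; rewrite -val_eqE /= => /negbTE ik.
by rewrite (onbP eps).1 eq_sym ik scale0r.
Qed.

Let ps_span x : hspan (range eps) x ->
  exists n0, forall n, (n0 <= n)%N -> ps x n = x.
Proof.
move=> [s [+ ->]]; elim: s => [_|p s IH H].
  exists 0%N => n _; rewrite big_nil /ps big1// => k _.
  by rewrite linear0l scale0r.
have [n1 h1] := IH (fun q qs => H q (@mem_behead _ (p :: s) q qs)).
have [k _ kE] := H p (mem_head _ _).
exists (maxn n1 k.+1) => n; rewrite geq_max => /andP[n1n kn].
by rewrite big_cons ps_lin h1// -kE ps_eps.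
Qed.

Definition bessel x n : R :=
  \sum_(k < n) ((Re '[x, eps k]) ^+ 2 + (Im '[x, eps k]) ^+ 2).

Let ReS (I : Type) (s : seq I) (F : I -> R[i]) :
  Re (\sum_(i <- s) F i) = \sum_(i <- s) Re (F i).
Proof. by elim/big_rec2 : _ => // i u v _ <-; rewrite ReD. Qed.

Let ps_self x n : Re '[ps x n, x] = bessel x n.
Proof.
rewrite hdot_suml ReS; apply: eq_bigr => k _.
rewrite hdotZl (hdot_conj (eps k)); case: '[x, eps k] => a b /=.
by rewrite mulrN opprK !expr2.
Qed.

Let ps_ps x n : hnorm (ps x n) ^+ 2 = bessel x n.
Proof.
rewrite hnorm_sqr {1}/ps hdot_suml ReS; apply: eq_bigr => k _.
rewrite hdotZl (hdot_conj (eps k)) ps_dot//; case: '[x, eps k] => a b /=.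
by rewrite mulrN opprK !expr2.
Qed.

Let ps_dist x n : hnorm (x - ps x n) ^+ 2 = hnorm x ^+ 2 - bessel x n.
Proof.
rewrite hnorm_sqrD hnorm_opp ps_ps linearNr.
have -> : Re (- '[x, ps x n]) = - Re '[x, ps x n] by case: '[x, ps x n].
by rewrite Re_hdotC ps_self; lra.
Qed.

Lemma bessel_cvg x : bessel x @ \oo --> hnorm x ^+ 2.
Proof.
apply/cvgrPdist_lt => e e0.
have se0 : 0 < Num.sqrt e by rewrite sqrtr_gt0.
have : hclosure (hspan (range eps)) x by rewrite (onbP eps).2.
move=> /(_ _ se0)[y /ps_span[n0 yE] xy].
exists n0 => // n /= n0n; rewrite -ps_dist ger0_norm ?sqr_ge0//.
have -> : x - ps x n = (x - y) - ps (x - y) n.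
  have -> : x - y = (-1) *: y + x by rewrite scaleN1r addrC.
  rewrite ps_lin yE// scaleN1r opprD opprK.
  by rewrite addrACA addNr add0r.
rewrite ps_dist; apply: (@le_lt_trans _ _ (hnorm (x - y) ^+ 2)).
  rewrite lerBlDr lerDl sumr_ge0// => k _.
  by rewrite addr_ge0 ?sqr_ge0.
rewrite -[ltRHS](sqr_sqrtr (ltW e0)) ltr_pXn2r// nnegrE ?hnorm_ge0//.
Qed.

End Bessel.

HB.mixin Record isHilbert (R : realType) U of PreHilbert R U := {
  hcomplete : forall u : nat -> U,
    (forall e : R, 0 < e -> exists n0, forall m n,
       (n0 <= m)%N -> (n0 <= n)%N -> hnorm (u m - u n) < e) ->
    exists l : U, forall e : R, 0 < e -> exists n0, forall n,
       (n0 <= n)%N -> hnorm (u n - l) < e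
}.

#[short(type="hilbertType")]
HB.structure Definition Hilbert (R : realType) :=
  {U of PreHilbert R U & isHilbert R U}.

Section Circle.
Variable R : realType.

Definition circle := {z : R[i] | `|z| == 1}.

Let circle1 : `|1 : R[i]| == 1.
Proof. by rewrite normr1. Qed.

HB.instance Definition _ := Choice.on circle.
HB.instance Definition _ := isPointed.Build circle (exist _ 1 circle1).

Definition circle_open : set (set circle) :=
  [set A | exists2 O : set (R[i] : numFieldType), open O & A = sval @^-1` O].

(* Borel sigma-algebra, generated by the relatively open sets *)
Definition torus := g_sigma_algebraType circle_open.
HB.instance Definition _ := Measurable.on torus.

Let expi_subproof (t : R) : `|(cos t +i* sin t : R[i])| == 1.
Proof. by rewrite normc_def /= cos2Dsin2 sqrtr1. Qed.

Definition expi (t : R) : torus := exist _ (cos t +i* sin t) (expi_subproof t).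

Let open_part (f : R[i] -> R) (a b : R) :
    (forall z w, `|f z - f w| <=
      Num.sqrt (Re (z - w) ^+ 2 + Im (z - w) ^+ 2)) ->
  open [set z : (R[i] : numFieldType) | a < f z < b].
Proof.
move=> f1; rewrite openE => z /= /andP[az zb].
apply/nbhs_ballP; exists (Num.min (f z - a) (b - f z))%:C => /=.
  by rewrite ltcR lt_min !subr_gt0 az zb.
move=> w; rewrite -ball_normE /= normc_def ltcR => /(le_lt_trans (f1 z w)).
by rewrite lt_min !ltr_norml; lra.
Qed.

Lemma torus_Re : measurable_fun [set: torus] (fun xi : torus => Re (sval xi)).
Proof.
apply: (measurability _ (RGenOpens.measurableE R)) => _ [_ [a [b ->]] <-].
apply: sub_sigma_algebra; rewrite setTI.
exists [set z : (R[i] : numFieldType) | a < Re z < b].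
  apply: open_part => -[? ?] [? ?] /=.
  by rewrite -sqrtr_sqr ler_wsqrtr// lerDl sqr_ge0.
by apply/seteqP; split => z /=; rewrite in_itv.
Qed.

Lemma torus_Im : measurable_fun [set: torus] (fun xi : torus => Im (sval xi)).
Proof.
apply: (measurability _ (RGenOpens.measurableE R)) => _ [_ [a [b ->]] <-].
apply: sub_sigma_algebra; rewrite setTI.
exists [set z : (R[i] : numFieldType) | a < Im z < b].
  apply: open_part => -[? ?] [? ?] /=.
  by rewrite -sqrtr_sqr ler_wsqrtr// lerDr sqr_ge0.
by apply/seteqP; split => z /=; rewrite in_itv.
Qed.

End Circle.

Section DirectIntegral.
Local Open Scope quotient_scope.
Variables (R : realType) (mu : {measure set (torus R) -> \bar R}).
Variables (E : hilbertType R) (eps : onb E) (N : torus R -> option nat).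
Implicit Types f g : torus R -> E.

(* [eps k] is the (k+1)-st basis vector, and [None] encodes infinity. *)
Definition fiber (xi : torus R) : set E :=
  hclosure (hspan [set eps k | k in
    [set k : nat | if N xi is Some n then (k < n)%N else true]]).

(* E is separable, so weak and strong measurability coincide (Pettis). *)
Definition weakly_measurable f := forall e : E,
  measurable_fun [set: torus R] (fun xi => Re '[f xi, e]) /\
  measurable_fun [set: torus R] (fun xi => Im '[f xi, e]).

Definition dint_fun : {pred torus R -> E} := fun f => `[<
  [/\ weakly_measurable f,
      mu.-integrable [set: torus R] (fun xi => (hnorm (f xi) ^+ 2)%:E) &
      {ae mu, forall xi, fiber xi (f xi)}] >].

Let mZ a f : weakly_measurable f -> weakly_measurable (a *: f).
Proof.
move=> mf e; have [m1 m2] := mf e.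
have H xi : '[(a *: f) xi, e] = a * '[f xi, e] by rewrite hdotZl.
split.
  rewrite (_ : (fun _ => _) = fun xi =>
    Re a * Re '[f xi, e] - Im a * Im '[f xi, e]); last first.
    by apply/funext => xi; rewrite H; case: a '[f xi, e] {H} => ? ? [].
  by apply: measurable_funB; apply: measurable_funM.
rewrite (_ : (fun _ => _) = fun xi =>
  Re a * Im '[f xi, e] + Im a * Re '[f xi, e]); last first.
  by apply/funext => xi; rewrite H; case: a '[f xi, e] {H} => ? ? [].
by apply: measurable_funD; apply: measurable_funM.
Qed.

Let mD f g : weakly_measurable f -> weakly_measurable g ->
  weakly_measurable (f + g).
Proof.
move=> mf mg e; have [m1 m2] := mf e; have [m3 m4] := mg e.
have H xi : '[(f + g) xi, e] = '[f xi, e] + '[g xi, e] by rewrite hdotDl.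
split.
  rewrite (_ : (fun _ => _) = fun xi => Re '[f xi, e] + Re '[g xi, e]).
    exact: measurable_funD.
  by apply/funext => xi; rewrite H ReD.
rewrite (_ : (fun _ => _) = fun xi => Im '[f xi, e] + Im '[g xi, e]).
  exact: measurable_funD.
by apply/funext => xi; rewrite H ImD.
Qed.

Let mN f : weakly_measurable f ->
  measurable_fun [set: torus R] (fun xi => hnorm (f xi) ^+ 2).
Proof.
move=> mf; apply: (measurable_fun_cvg (h := fun n xi => bessel eps (f xi) n)).
  move=> n; apply: measurable_sum => k.
  by apply: measurable_funD; apply: measurable_funX; apply: (mf _).1 || apply: (mf _).2.
by move=> xi _; exact: bessel_cvg.
Qed.

Let sqint f := mu.-integrable [set: torus R]
  (fun xi => (hnorm (f xi) ^+ 2)%:E).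

Let sqintZ a f : weakly_measurable f -> sqint f -> sqint (a *: f).
Proof.
move=> mf fi; have := integrableZl measurableT (Re a ^+ 2 + Im a ^+ 2) fi.
apply: eq_integrable => //.
by move=> xi _; rewrite -EFinM -hnorm_sqrZ.
Qed.

Let sqintD f g : weakly_measurable f -> weakly_measurable g ->
  sqint f -> sqint g -> sqint (f + g).
Proof.
move=> mf mg fi gi.
have := integrableZl measurableT 2 (integrableD measurableT fi gi).
apply: le_integrable => //.
  by apply/measurable_EFinP; exact: (mN (mD mf mg)).
move=> xi _ /=; rewrite lee_fin !ger0_norm ?sqr_ge0//.
  exact: hnorm_sqrD_le.
by rewrite mulr_ge0// addr_ge0 ?sqr_ge0.
Qed.

Lemma dint_fun_submod : submod_closed dint_fun.
Proof.
split.
  apply/asboolP; split.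
  - move=> e; rewrite (_ : (fun _ => Re _) = cst 0).
      rewrite (_ : (fun _ => Im _) = cst 0); first by split.
      by apply/funext => xi; rewrite linear0l.
    by apply/funext => xi; rewrite linear0l.
  - rewrite (_ : (fun _ => _) = cst 0%E); first exact: integrable0.
    by apply/funext => xi; rewrite hnorm_sqr linear0l.
  - by apply: aeW => xi; exact: hclosure_span0.
move=> a f g /asboolP[mf fi fE] /asboolP[mg gi gE]; apply/asboolP; split.
- by apply: mD => //; exact: mZ.
- by apply: sqintD => //; [exact: mZ|exact: sqintZ].
- by apply: filterS2 fE gE => xi fE gE; exact: hclosure_span_lin.
Qed.

HB.instance Definition _ :=
  GRing.isSubmodClosed.Build _ _ dint_fun dint_fun_submod.

Record dint_rep := DintRep { dint_val :> torus R -> E; _ : dint_val \in dint_fun }.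
HB.instance Definition _ := [isSub for dint_val].
HB.instance Definition _ := [Choice of dint_rep by <:].
HB.instance Definition _ := [SubChoice_isSubLmodule of dint_rep by <:].

Definition dint_eq (f g : dint_rep) := `[< {ae mu, forall xi, f xi = g xi} >].

Let dint_eq_refl : reflexive dint_eq.
Proof. by move=> f; apply/asboolP/aeW. Qed.

Let dint_eq_sym : symmetric dint_eq.
Proof.
by move=> f g; apply/asboolP/asboolP; apply: filterS => xi ->.
Qed.

Let dint_eq_trans : transitive dint_eq.
Proof.
move=> g f h /asboolP fg /asboolP gh; apply/asboolP.
by apply: filterS2 fg gh => xi -> ->.
Qed.

Canonical dint_eq_equiv := EquivRel dint_eq dint_eq_refl dint_eq_sym dint_eq_trans.

Definition dintegral : Type := {eq_quot dint_eq}.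
HB.instance Definition _ := Choice.on dintegral.
HB.instance Definition _ := EqQuotient.on dintegral.

Implicit Types x y z : dintegral.
Implicit Types u v w : dint_rep.

Lemma dint_pi_eq u v :
  \pi_dintegral u = \pi v <-> {ae mu, forall xi, u xi = v xi}.
Proof.
split => [/eqP|h]; first by rewrite piE => /asboolP.
by apply/eqP; rewrite piE; apply/asboolP.
Qed.

Lemma dint_reprK u : {ae mu, forall xi, repr (\pi_dintegral u) xi = u xi}.
Proof. by apply/dint_pi_eq; rewrite reprK. Qed.

Definition dint_zero : dintegral := \pi_dintegral 0.
Definition dint_opp x : dintegral := \pi_dintegral (- repr x).
Definition dint_add x y : dintegral := \pi_dintegral (repr x + repr y).
Definition dint_scale (a : R[i]) x : dintegral := \pi_dintegral (a *: repr x).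

Let pi_opp u : dint_opp (\pi_dintegral u) = \pi_dintegral (- u).
Proof.
apply/dint_pi_eq; apply: filterS (dint_reprK u) => xi /= ue.
by rewrite !fctE ue.
Qed.

Let pi_add u v :
  dint_add (\pi_dintegral u) (\pi_dintegral v) = \pi_dintegral (u + v).
Proof.
apply/dint_pi_eq; apply: filterS2 (dint_reprK u) (dint_reprK v) => xi /= ue ve.
by rewrite !fctE ue ve.
Qed.

Let pi_scale a u : dint_scale a (\pi_dintegral u) = \pi_dintegral (a *: u).
Proof.
apply/dint_pi_eq; apply: filterS (dint_reprK u) => xi /= ue.
by rewrite !fctE ue.
Qed.

Let addqA : associative dint_add.
Proof.
move=> x y z; rewrite -[x]reprK -[y]reprK -[z]reprK.
move: (repr x) (repr y) (repr z) => u v w.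
by rewrite (pi_add v w) (pi_add u v) (pi_add u) (pi_add _ w) addrA.
Qed.

Let addqC : commutative dint_add.
Proof. by move=> x y; congr (\pi); rewrite addrC. Qed.

Let add0q : left_id dint_zero dint_add.
Proof. by move=> x; rewrite -[x]reprK (pi_add 0) add0r. Qed.

Let addNq : left_inverse dint_zero dint_opp dint_add.
Proof. by move=> x; rewrite -[x]reprK (pi_opp (repr x)) (pi_add _ (repr x)) addNr. Qed.

HB.instance Definition _ :=
  GRing.isZmodule.Build dintegral addqA addqC add0q addNq.

Let scaleqA a b x : dint_scale a (dint_scale b x) = dint_scale (a * b) x.
Proof. by rewrite -[x]reprK (pi_scale b) (pi_scale a) (pi_scale (a * b)) scalerA. Qed.

Let scale1q : left_id 1 dint_scale.
Proof. by move=> x; rewrite -[x]reprK pi_scale scale1r. Qed.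

Let scaleqDr : right_distributive dint_scale +%R.
Proof.
move=> a x y; rewrite -[x]reprK -[y]reprK.
move: (repr x) (repr y) => u v.
rewrite /GRing.add /= (pi_add u v) !(pi_scale a) (pi_add (a *: u)).
by rewrite scalerDr.
Qed.

Let scaleqDl x : {morph dint_scale^~ x : a b / a + b}.
Proof.
move=> a b; rewrite -[x]reprK; move: (repr x) => u.
rewrite (pi_scale (a + b)) (pi_scale a) (pi_scale b).
by rewrite [RHS](pi_add (a *: u)) scalerDl.
Qed.

HB.instance Definition _ := GRing.Zmodule_isLmodule.Build R[i] dintegral
  scaleqA scale1q scaleqDr scaleqDl.

Lemma dint_piD u v :
  \pi_dintegral (u + v) = \pi_dintegral u + \pi_dintegral v.
Proof. by rewrite -pi_add. Qed.

Lemma dint_piZ a u : \pi_dintegral (a *: u) = a *: \pi_dintegral u.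
Proof. by rewrite -pi_scale. Qed.

Lemma dint_pi0 : \pi_dintegral 0 = 0 :> dintegral.
Proof. by []. Qed.

Definition cintegral (h : torus R -> R[i]) : R[i] :=
  (\int[mu]_xi Re (h xi)) +i* (\int[mu]_xi Im (h xi)).

Definition dint_dot x y := cintegral (fun xi => '[repr x xi, repr y xi]).

Let repP u : [/\ weakly_measurable u, sqint u &
  {ae mu, forall xi, fiber xi (u xi)}].
Proof. by case: u => u /= /asboolP. Qed.

Let int_Re u v :
  mu.-integrable [set: torus R] (EFin \o (fun xi => Re '[u xi, v xi])).
Proof.
have [mu_ iu _] := repP u; have [mv iv _] := repP v.
have := integrableD measurableT iu iv.
apply: le_integrable => //.
  apply/measurable_EFinP; rewrite (_ : (fun _ => _) = fun xi =>
    (hnorm ((u + v : torus R -> E) xi) ^+ 2 - hnorm (u xi) ^+ 2 -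
      hnorm (v xi) ^+ 2) * 2^-1).
    apply: measurable_funM => //; apply: measurable_funB; last exact: mN.
    by apply: measurable_funB; [exact: (mN (mD mu_ mv))|exact: mN].
  by apply/funext => xi; rewrite Re_hdot_polar.
move=> xi _ /=; rewrite lee_fin (le_trans (Re_hdot_le _ _))//.
exact: ler_norm.
Qed.

Let int_Im u v :
  mu.-integrable [set: torus R] (EFin \o (fun xi => Im '[u xi, v xi])).
Proof.
have := int_Re u ('i *: v); apply: eq_integrable => // xi _ /=.
by rewrite Im_hdot.
Qed.

Lemma dint_dot_pi u v : dint_dot (\pi_dintegral u) (\pi_dintegral v) =
  cintegral (fun xi => '[u xi, v xi]).
Proof.
congr (_ +i* _); congr fine; apply: ae_eq_integral => //.
- exact: measurable_int (int_Re _ _).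
- exact: measurable_int (int_Re _ _).
- apply: filterS2 (dint_reprK u) (dint_reprK v) => xi ue ve _ /=.
  by rewrite ue ve.
- exact: measurable_int (int_Im _ _).
- exact: measurable_int (int_Im _ _).
- apply: filterS2 (dint_reprK u) (dint_reprK v) => xi ue ve _ /=.
  by rewrite ue ve.
Qed.

Let cint_D u v w : cintegral (fun xi => '[(u + v) xi, w xi]) =
  cintegral (fun xi => '[u xi, w xi]) + cintegral (fun xi => '[v xi, w xi]).
Proof.
congr (_ +i* _); rewrite -RintegralD//; apply: eq_Rintegral => xi _ /=.
- by rewrite hdotDl ReD.
- by rewrite hdotDl ImD.
Qed.

Let intZ (a : R) (h : torus R -> R) :
  mu.-integrable [set: torus R] (EFin \o h) ->
  mu.-integrable [set: torus R] (EFin \o (fun xi => a * h xi)).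
Proof. by move=> ih; have := integrableZl measurableT a ih. Qed.

Let cint_Z a u w : cintegral (fun xi => '[(a *: u) xi, w xi]) =
  a * cintegral (fun xi => '[u xi, w xi]).
Proof.
rewrite /cintegral; case: a => a b; rewrite [RHS]/GRing.mul /=.
rewrite -!RintegralZl// -RintegralB//; [|exact: intZ|exact: intZ].
rewrite -RintegralD//; [|exact: intZ|exact: intZ].
congr (_ +i* _); apply: eq_Rintegral => xi _ /=;
  by rewrite hdotZl; case: '[_, _].
Qed.

Let dot_linear y : scalar (dint_dot ^~ y).
Proof.
move=> a x x'; rewrite -[x]reprK -[x']reprK -[y]reprK -dint_piZ -dint_piD.
by rewrite !dint_dot_pi cint_D cint_Z.
Qed.

Let dot_conj x y : dint_dot x y = Num.conj (dint_dot y x).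
Proof.
rewrite [RHS](_ : _ = (\int[mu]_xi Re '[repr y xi, repr x xi]) +i*
  (- \int[mu]_xi Im '[repr y xi, repr x xi]))//; congr (_ +i* _).
  by apply: eq_Rintegral => xi _; rewrite Re_hdotC.
rewrite -mulN1r -RintegralZl//; apply: eq_Rintegral => xi _.
by rewrite hdot_conj conjIm mulN1r.
Qed.

Let dot_gt0 x : x != 0 -> 0 < dint_dot x x.
Proof.
move=> x0; have [_ ix _] := repP (repr x).
have -> : dint_dot x x = (\int[mu]_xi (hnorm (repr x xi) ^+ 2))%:C.
  congr (_ +i* _).
    by apply: eq_Rintegral => xi _; rewrite hnorm_sqr.
  rewrite -[RHS](mul0r (\int[mu]_xi (hnorm (repr x xi) ^+ 2))).
  rewrite -RintegralZl//; apply: eq_Rintegral => xi _.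
  by rewrite hdot_self mul0r.
rewrite ltcR lt_neqAle Rintegral_ge0 ?andbT; last by move=> *; exact: sqr_ge0.
apply: contra x0 => /eqP/esym I0; apply/eqP.
have mx : measurable_fun [set: torus R]
    (fun xi => (hnorm (repr x xi) ^+ 2)%:E) := measurable_int _ ix.
have I1 : (\int[mu]_xi `|(hnorm (repr x xi) ^+ 2)%:E| = 0)%E.
  under eq_integral do rewrite /= ger0_norm ?sqr_ge0//.
  rewrite -[LHS]fineK; last exact: integrable_fin_num ix.
  by rewrite -[fine _]/(Rintegral _ _ _) I0.
rewrite -[x]reprK -dint_pi0; apply/dint_pi_eq.
apply: filterS ((ae_eq_integral_abs mu measurableT mx).1 I1) => xi /(_ I).
move=> -[/= h]; apply/eqP; rewrite -(dnorm_eq0 (@hdot R E)) /= (hdot_self (repr x xi)) h.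
by rewrite eq_complex /= !eqxx.
Qed.

HB.instance Definition _ :=
  isPreHilbert.Build R dintegral dot_linear dot_conj dot_gt0.

Let mulxi_subproof u : (fun xi : torus R => sval xi *: u xi) \in dint_fun.
Proof.
have [mu_ iu fu] := repP u; apply/asboolP; split.
- move=> e; have [m1 m2] := mu_ e; split.
    rewrite (_ : (fun _ => _) = fun xi =>
      Re (sval xi) * Re '[u xi, e] - Im (sval xi) * Im '[u xi, e]).
      apply: measurable_funB; apply: measurable_funM => //.
        exact: torus_Re.
      exact: torus_Im.
    by apply/funext => xi; rewrite hdotZl; case: (sval xi) '[_, _] => ? ? [].
  rewrite (_ : (fun _ => _) = fun xi =>
    Re (sval xi) * Im '[u xi, e] + Im (sval xi) * Re '[u xi, e]).
    apply: measurable_funD; apply: measurable_funM => //.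
      exact: torus_Re.
    exact: torus_Im.
  by apply/funext => xi; rewrite hdotZl; case: (sval xi) '[_, _] => ? ? [].
- apply: eq_integrable iu => // xi _; congr EFin; rewrite hnorm_sqrZ.
  have /eqP := svalP xi; rewrite normc_def => -[] z1.
  by rewrite -[X in X * _](sqr_sqrtr) ?z1 ?expr1n ?mul1r// addr_ge0 ?sqr_ge0.
- apply: filterS fu => xi uxi; rewrite -[_ *: _]addr0.
  by apply: hclosure_span_lin => //; exact: hclosure_span0.
Qed.

Definition Mxi x : dintegral := \pi_dintegral (DintRep (mulxi_subproof (repr x))).

End DirectIntegral.

Section ColumnVectors.
Variables (R : realType) (d : nat).
Implicit Types x y : 'cV[R[i]]_d.

Let cdot x y : R[i] := \sum_i x i 0 * Num.conj (y i 0).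

Let cdot_linear y : scalar (cdot ^~ y).
Proof.
move=> a x x'; rewrite /cdot mulr_sumr -big_split; apply: eq_bigr => i _ /=.
by rewrite !mxE mulrDl mulrA.
Qed.

Let cdot_conj x y : cdot x y = Num.conj (cdot y x).
Proof.
rewrite /cdot rmorph_sum; apply: eq_bigr => i _ /=.
by rewrite rmorphM /= conjCK mulrC.
Qed.

Let cdot_gt0 x : x != 0 -> 0 < cdot x x.
Proof.
move=> x0; rewrite lt_neqAle eq_sym sumr_ge0 ?andbT; last first.
  by move=> i _; exact: mul_conjC_ge0.
apply: contra x0; rewrite psumr_eq0; last by move=> i _; exact: mul_conjC_ge0.
move=> /allP h; apply/eqP/matrixP => i j; rewrite ord1 mxE.
by have /= := h i (mem_index_enum i); rewrite mul_conjC_eq0 => /eqP.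
Qed.

HB.instance Definition _ :=
  isPreHilbert.Build R 'cV[R[i]]_d cdot_linear cdot_conj cdot_gt0.

End ColumnVectors.

Section Operators.
Variable R : realType.

(* op_adj, op_inv and op_sqrt select the (unique) operator with the stated
   property if there is one, and are 0 otherwise.  A positive operator whose
   square is bounded is itself bounded, so boundedness is not required. *)

Definition op_adj (U V : preHilbertType R) (A : U -> V) : V -> U :=
  xget (fun=> 0) [set A' | forall x y, '[A x, y] = '[x, A' y]].

Definition op_inv (U : preHilbertType R) (A : U -> U) : U -> U :=
  xget (fun=> 0) [set A' | cancel A A' /\ cancel A' A].

Definition positive_op (U : preHilbertType R) (A : U -> U) :=
  linear A /\ forall x, 0 <= '[A x, x].

Definition op_sqrt (U : preHilbertType R) (A : U -> U) : U -> U :=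
  xget (fun=> 0) [set S | positive_op S /\ forall x, S (S x) = A x].

Definition defect (U V : preHilbertType R) (A : U -> V) : U -> U :=
  op_sqrt (fun x => x - op_adj A (A x)).

Definition defect_adj (U V : preHilbertType R) (A : U -> V) : V -> V :=
  op_sqrt (fun y => y - A (op_adj A y)).

Definition mx_of_op d (A : 'cV[R[i]]_d -> 'cV[R[i]]_d) : 'M[R[i]]_d :=
  \matrix_(i, j) A (delta_mx j 0) i 0.

Definition mx_defect d (A : 'M[R[i]]_d) : 'M[R[i]]_d :=
  mx_of_op (defect (mulmx A : 'cV_d -> 'cV_d)).

Definition isometric (U V : preHilbertType R) (A : U -> V) :=
  forall x, hnorm (A x) = hnorm x.

Definition strict_contraction d (A : 'M[R[i]]_d) :=
  forall x : 'cV[R[i]]_d, x != 0 -> hnorm (A *m x) < hnorm x.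

(* The coordinate operators V and Vs, which are unitary from the defect spaces
   of T and of its adjoint onto C^d, are extended by 0 to the orthogonal
   complements of these spaces, so that op_adj V takes its values in the
   defect space of T. *)
Definition charfun (H : preHilbertType R) d (T : H -> H)
    (V Vs : H -> 'cV[R[i]]_d) (z : R[i]) : 'M[R[i]]_d :=
  mx_of_op (fun c =>
    let x := op_adj V c in
    Vs (- T x +
        z *: defect_adj T (op_inv (fun y => y - z *: op_adj T y) (defect T x)))).

Definition stolz (a : R) (xi : torus R) : set R[i] :=
  [set z | `|z| < 1 /\ `|z - sval xi| < a%:C * (1 - `|z|)].

(* a.e. with respect to arc length *)
Definition ae_circle (P : torus R -> Prop) :=
  {ae lebesgue_measure, forall t : R, P (expi t)}.

Definition nontangential_limit d (theta : R[i] -> 'M[R[i]]_d) (xi : torus R)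
    (A : 'M[R[i]]_d) :=
  forall a : R, 1 < a ->
    (theta : (R[i] : numFieldType) -> 'M[(R[i] : numFieldType)]_d) z
      @[z --> within (stolz a xi) (nbhs (sval xi : (R[i] : numFieldType)))]
    --> (A : 'M[(R[i] : numFieldType)]_d).

Definition boundary_values d (theta : R[i] -> 'M[R[i]]_d)
    (b : torus R -> 'M[R[i]]_d) :=
  ae_circle (fun xi => nontangential_limit theta xi (b xi)).

End Operators.

Section Perturbation.
Variables (R : realType) (H : preHilbertType R) (d : nat).

Definition perturbation (U : H -> H) (B : 'cV[R[i]]_d -> H)
    (G : 'M[R[i]]_d) : H -> H :=
  fun x => U x + B ((G - 1%:M) *m op_adj B (U x)).

Definition char_theta (U : H -> H) (B : 'cV[R[i]]_d -> H) (G : 'M[R[i]]_d) :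
    R[i] -> 'M[R[i]]_d :=
  charfun (perturbation U B G) (op_adj B \o U) (op_adj B).

End Perturbation.

(* Main.v *)
Require Import Defs.
From HB Require Import structures.
From mathcomp Require Import all_boot all_order all_algebra.
From mathcomp Require Import sesquilinear spectral generic_quotient complex.
From mathcomp Require Import all_classical all_reals all_analysis.
From mathcomp Require Import measurable_realfun ring lra.

Set Implicit Arguments.
Unset Strict Implicit.
Unset Printing Implicit Defensive.

Import Order.TTheory GRing.Theory Num.Theory.
Import numFieldNormedType.Exports.

Local Open Scope classical_set_scope.
Local Open Scope complex_scope.
Local Open Scope sesquilinear_scope.
Local Open Scope ring_scope.

Local Notation Re := complex.Re.
Local Notation Im := complex.Im.
Local Notation "''[' x , y ]" := (hdot x y) : ring_scope.

(** Primes denote adjoints. Write [T_G] for the rank [d] perturbation of the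
    unitary operator [U] and [theta_G] for its characteristic function. Since
    [T_G' = T_0' + U' B G' B'], a solution [x] of [x - z T_G' x = U' B D_G c]
    also solves the resolvent equation of [T_0] with right-hand side
    [U' B (D_G c + z G' B' x)]. Reading off [z B' x] from both equations gives,
    inside the disc,
      [(1 - theta_0 G') E (theta_G + G) = theta_0 D_G],
    where [E] is the inverse of the defect of [G']: a Moebius transformation
    relating [theta_0] and [theta_G] ([char_theta_mobius]). In this form both
    sides are polynomial in the two characteristic functions, so the equation
    passes to nontangential limits entry by entry, with no inverse to control.
    The boundary values of [theta_0] are contractions as limits of contractions
    ([char_theta0_contraction]). At a boundary point where both limits exist
    the rest is matrix algebra: [G] being a strict contraction makes
    [1 - theta_0 G'] and [1 - G' theta_0] invertible, one solves for [theta_G]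
    and expands [1 - theta_G' theta_G], using that [G] intertwines its two
    defects ([mobius_defect]).

    Two points need work before this argument starts. The operators in the
    definition of [theta_G] are selected by a characteristic property, so each
    has to be exhibited and shown to be unique. For square roots this is done
    on eigenvectors: a positive [S] with [S (S x) = s ^+ 2 *: x] and [0 <= s]
    satisfies [S x = s *: x] ([positive_op_eigen]), and the defects of [T_G]
    and [T_G'] vanish on the complement of a finite-dimensional space that is
    spanned by eigenvectors ([op_sqrtE]). The resolvent of [T_G'] is built
    without appealing to completeness of the direct integral: [1 - z U'] is
    inverted by multiplication by [1 / (1 - z conj xi)] ([Mxi_resolvent]), and
    the finite rank perturbation leaves a [d] by [d] linear system
    ([pert_resolvent]). *)

(** * Adjoints and positive operators *)

Section Adjoints.
Variable R : realType.

Definition adjoint (U V : preHilbertType R) (A : U -> V) (A' : V -> U) :=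
  forall x y, '[A x, y] = '[x, A' y].

Lemma hdot_inj (U : preHilbertType R) (x y : U) :
  (forall z, '[z, x] = '[z, y]) -> x = y.
Proof.
move=> h; apply/eqP; rewrite -subr_eq0; apply/contraT => /hdot_gt0.
by rewrite linearBr /= h subrr ltxx.
Qed.

Lemma linear_add (U V : lmodType R[i]) (f : U -> V) x y :
  linear f -> f (x + y) = f x + f y.
Proof. by move=> h; have := h 1 x y; rewrite !scale1r. Qed.

Lemma linear_zero (U V : lmodType R[i]) (f : U -> V) : linear f -> f 0 = 0.
Proof.
by move=> h; have := h (-1) 0 0; rewrite scaler0 addr0 scaleN1r addNr.
Qed.

Lemma linear_scale (U V : lmodType R[i]) (f : U -> V) a x :
  linear f -> f (a *: x) = a *: f x.
Proof. by move=> h; have := h a x 0; rewrite (linear_zero h) !addr0. Qed.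

Lemma linear_sub (U V : lmodType R[i]) (f : U -> V) x y :
  linear f -> f (x - y) = f x - f y.
Proof.
move=> h; rewrite -scaleN1r (linear_add _ _ h) (linear_scale _ _ h).
by rewrite scaleN1r.
Qed.

Lemma subr_eq_of (V : zmodType) (x y u v : V) : u = v -> x - y = u - v -> x = y.
Proof. by move=> -> /eqP; rewrite subrr subr_eq0 => /eqP. Qed.

Lemma op_adjE (U V : preHilbertType R) (A : U -> V) A' :
  adjoint A A' -> op_adj A = A'.
Proof.
move=> h; apply/funext => y; apply: hdot_inj => x; rewrite -h.
by rewrite (@xgetPex _ (fun=> 0) [set A' | adjoint A A'] (ex_intro _ A' h)).
Qed.

Lemma adjoint_sym (U V : preHilbertType R) (A : U -> V) A' :
  adjoint A A' -> adjoint A' A.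
Proof. by move=> h x y; rewrite hdot_conj -h -hdot_conj. Qed.

Lemma adjoint_linear (U V : preHilbertType R) (A : U -> V) A' :
  adjoint A A' -> linear A.
Proof.
move=> h a x y; apply: hdot_inj => z.
by rewrite hdotDr hdotZr -!(adjoint_sym h) hdotDr hdotZr.
Qed.

Lemma adjoint_comp (U V W : preHilbertType R) (A : U -> V) A' (B : V -> W) B' :
  adjoint A A' -> adjoint B B' -> adjoint (B \o A) (A' \o B').
Proof. by move=> hA hB x y /=; rewrite hB hA. Qed.

Lemma hdot_eq0 (U : preHilbertType R) (x : U) : '[x, x] = 0 -> x = 0.
Proof.
by move=> h; apply/eqP/contraT => /hdot_gt0; rewrite h ltxx.
Qed.

Lemma hdot_ge0 (U : preHilbertType R) (x : U) : 0 <= '[x, x].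
Proof. by rewrite hdot_self lecR sqr_ge0. Qed.

Lemma hdot_sub (U : preHilbertType R) (x y z : U) :
  '[x - y, z] = '[x, z] - '[y, z].
Proof. exact: linearBl. Qed.

Lemma hnorm_leE (U V : preHilbertType R) (x : U) (y : V) :
  (hnorm x <= hnorm y) = ('[x, x] <= '[y, y]).
Proof.
by rewrite !hdot_self lecR ler_pXn2r ?nnegrE ?hnorm_ge0.
Qed.

Lemma hnorm_ltE (U V : preHilbertType R) (x : U) (y : V) :
  (hnorm x < hnorm y) = ('[x, x] < '[y, y]).
Proof.
by rewrite !hdot_self ltcR ltr_pXn2r ?nnegrE ?hnorm_ge0.
Qed.

(** Over the complex numbers positivity already forces symmetry, by
    polarization with the two coefficients 1 and i. *)
Lemma positive_op_sym (U : preHilbertType R) (S : U -> U) :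
  positive_op S -> adjoint S S.
Proof.
move=> [linS posS] x y.
have SD u v := linear_add u v linS; have SZ a u := linear_scale a u linS.
have h u : '[S u, u] = '[u, S u].
  rewrite [RHS]hdot_conj; apply/esym/CrealP.
  by rewrite ger0_real.
have h1 := h (x + y); have h2 := h (x + 'i *: y).
rewrite SD !hdotDl !hdotDr h h in h1.
rewrite SD SZ !hdotDl !hdotDr !hdotZl !hdotZr h h in h2.
have ci : Num.conj ('i : R[i]) = - 'i.
  by apply/eqP; rewrite eq_complex /= oppr0 !eqxx.
rewrite ci in h2.
set a := '[S x, y] in h1 h2 *; set b := '[x, S y] in h1 h2 *.
set c := '[S y, x] in h1 h2 *; set e := '[y, S x] in h1 h2 *.
set f := '[x, S x] in h1 h2 *; set g := '[y, S y] in h1 h2 *.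
have h3 : a + c = b + e.
  by apply: (subr_eq_of h1); ring.
have h4 : 'i * (c - a) = 'i * (e - b).
  by apply: (subr_eq_of h2); ring.
have i0 : 'i != 0 :> R[i] by rewrite eq_complex /= oner_eq0 andbF.
have h5 := mulfI i0 h4.
have two : (2 : R[i]) != 0 by rewrite pnatr_eq0.
apply: (mulfI two); apply: (subr_eq_of (congr2 (fun u v => u - v) h3 h5)).
by ring.
Qed.

(** Eigenvectors determine a positive square root: with [y = S x - s *: x] one
    gets [S y = - s *: y], which positivity of [S] allows only for [y = 0]. The
    case [s = 0] is separate, since then [y] is [S x] and its norm vanishes by
    symmetry of [S]. *)
Lemma positive_op_eigen (U : preHilbertType R) (S : U -> U) (s : R[i]) x :
  positive_op S -> 0 <= s -> S (S x) = s ^+ 2 *: x -> S x = s *: x.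
Proof.
move=> pS s0 h; have [linS posS] := pS; have symS := positive_op_sym pS.
have SD u v := linear_add u v linS; have SZ a u := linear_scale a u linS.
have [s00|s1] := eqVneq s 0.
  rewrite s00 scale0r; apply: hdot_eq0; rewrite symS h s00 expr0n scale0r.
  by rewrite linear0r.
apply/eqP; rewrite -subr_eq0; apply/eqP/hdot_eq0.
set y := _ - _.
have Sy : S y = - s *: y.
  by rewrite /y (linear_sub _ _ linS) SZ h scaleNr scalerBr opprB scalerA expr2.
have := posS y; rewrite Sy hdotZl mulNr oppr_ge0 => le0.
apply/eqP; rewrite eq_le hdot_ge0 andbT.
by rewrite -(@pmulr_rle0 _ s)// lt_neqAle eq_sym s1.
Qed.

End Adjoints.

(** * Positive matrices *)

Section Matrices.
Variables (R : realType) (d : nat).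
Implicit Types (A D M P : 'M[R[i]]_d) (c x y : 'cV[R[i]]_d).

Definition positive_mx D := @positive_op R 'cV[R[i]]_d (mulmx D).

Lemma cdotE x y : '[x, y] = \sum_i x i 0 * Num.conj (y i 0).
Proof. by []. Qed.

Lemma mulmx_adjoint A :
  adjoint (mulmx A : 'cV[R[i]]_d -> 'cV[R[i]]_d) (mulmx (A^t*)).
Proof.
move=> x y; rewrite !cdotE.
under eq_bigr do rewrite mxE mulr_suml.
rewrite exchange_big; apply: eq_bigr => j _ /=.
rewrite mxE rmorph_sum mulr_sumr; apply: eq_bigr => i _.
by rewrite !mxE rmorphM /= conjCK mulrA [x j 0 * _]mulrC.
Qed.

Lemma mulmx_linear A : linear (mulmx A : 'cV[R[i]]_d -> 'cV[R[i]]_d).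
Proof. exact: linearP. Qed.

Lemma eq_mulmx A M : (forall c, A *m c = M *m c) -> A = M.
Proof.
move=> h; apply/matrixP => i j; have := h (delta_mx j 0).
by rewrite -!colE => /colP/(_ i); rewrite !mxE.
Qed.

Lemma mx_of_opE (f : 'cV[R[i]]_d -> 'cV[R[i]]_d) M :
  (forall c, f c = M *m c) -> mx_of_op f = M.
Proof.
by move=> h; apply/matrixP => i j; rewrite mxE h -colE mxE.
Qed.

Lemma mx_of_op_linear (f : 'cV[R[i]]_d -> 'cV[R[i]]_d) c :
  linear f -> f c = mx_of_op f *m c.
Proof.
move=> lf; pose F : {linear 'cV[R[i]]_d -> 'cV[R[i]]_d} :=
  HB.pack f (GRing.isLinear.Build _ _ _ _ f lf).
rewrite -[f c]/(F c) {1}[c]matrix_sum_delta.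
rewrite linear_sum; apply/colP => i; rewrite summxE mxE; apply: eq_bigr => j _.
by rewrite big_ord1 linearZ !mxE mulrC.
Qed.

Lemma unitmx_inj A : (forall c, A *m c = 0 -> c = 0) -> A \in unitmx.
Proof.
move=> h; rewrite -unitmx_tr -row_free_unit -kermx_eq0.
apply/eqP/row_matrixP => i.
rewrite row0; apply: trmx_inj; rewrite trmx0; apply: h.
apply: trmx_inj; rewrite trmx_mul trmxK trmx0.
by apply/sub_kermxP; exact: row_sub.
Qed.

Lemma positive_mx_hermitian D :
  positive_mx D -> D^t* = D.
Proof.
move=> pD; apply: eq_mulmx => c; apply: hdot_inj => x.
by rewrite -mulmx_adjoint -(positive_op_sym pD).
Qed.

Lemma positive_diag (s : 'rV[R[i]]_d) (V : 'M[R[i]]_d) :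
  (forall j, 0 <= s 0 j) ->
  positive_mx (V *m diag_mx s *m V^t*).
Proof.
move=> s0; split=> [|c]; first exact: mulmx_linear.
rewrite -!mulmxA mulmx_adjoint cdotE sumr_ge0// => i _.
by rewrite mul_diag_mx mxE -mulrA mulr_ge0// mul_conjC_ge0.
Qed.

(** Spectral theorem; the eigenvectors are the columns of [V]. *)
Lemma positive_mx_diag D : positive_mx D ->
  exists (V : 'M[R[i]]_d) (s : 'rV[R[i]]_d),
  [/\ V^t* *m V = 1%:M, D = V *m diag_mx s *m V^t* &
    forall j, 0 <= s 0 j].
Proof.
move=> pD; have hD := positive_mx_hermitian pD.
have nD : D \is normalmx by apply/normalmxP; rewrite hD.
have uQ := spectral_unitarymx D; have /orthomx_spectralP := nD.
rewrite invmx_unitary//; set Q := spectralmx D in uQ *.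
set s := spectral_diag D.
move=> eD; exists (Q^t*), s; rewrite trmxCK; split => // [|j].
  exact/unitarymxP.
have := pD.2 (Q^t* *m delta_mx j 0); rewrite {1}eD mulmxA.
rewrite -[_ *m Q *m Q^t*]mulmxA (unitarymxP uQ) mulmx1.
rewrite -[_ *m _ *m delta_mx j 0]mulmxA -{1}[Q in Q^t*]trmxCK.
rewrite mulmx_adjoint !trmxCK.
rewrite mulmxA (unitarymxP uQ) mul1mx cdotE (bigD1 j)//= big1 => [|i ij].
  by rewrite mul_diag_mx !mxE !eqxx conjC1 !mulr1 addr0.
by rewrite mul_diag_mx !mxE (negbTE ij) mulr0 mul0r.
Qed.

Lemma positive_mx_sqrt P : positive_mx P ->
  exists2 D, positive_mx D & D *m D = P.
Proof.
move=> /positive_mx_diag[V [s [VV -> s0]]].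
pose r := \row_j sqrtC (s 0 j).
exists (V *m diag_mx r *m V^t*).
  by apply: positive_diag => j; rewrite mxE sqrtC_ge0.
rewrite -!mulmxA; congr (_ *m _); rewrite [V^t* *m _]mulmxA VV mul1mx mulmxA.
congr (_ *m _); apply/matrixP => i j; rewrite mul_diag_mx !mxE.
case: eqP => [->|_]; last by rewrite !mulr0n mulr0.
by rewrite !mulr1n -expr2 sqrtCK.
Qed.

(** The eigenvectors of a positive matrix span the whole space, so that linear
    maps can be compared on them, where square roots are computable. *)
Lemma positive_mx_ext (V : lmodType R[i]) D (f g : 'cV[R[i]]_d -> V) :
  positive_mx D -> linear f -> linear g ->
  (forall s c, 0 <= s -> D *m c = s *: c -> f c = g c) -> f =1 g.
Proof.
move=> pD lf lg h c; have [W [s [WW eD s0]]] := positive_mx_diag pD.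
have WW' : W *m W^t* = 1%:M by exact: mulmx1C.
have DW : D *m W = W *m diag_mx s by rewrite eD -mulmxA WW mulmx1.
have F : forall y : 'cV[R[i]]_d, f (W *m y) = g (W *m y).
  move=> y; pose F : {linear 'cV[R[i]]_d -> V} :=
    HB.pack f (GRing.isLinear.Build _ _ _ _ f lf).
  pose G : {linear 'cV[R[i]]_d -> V} :=
    HB.pack g (GRing.isLinear.Build _ _ _ _ g lg).
  rewrite -[f _]/(F _) -[g _]/(G _) [y]matrix_sum_delta !linear_sum.
  apply: eq_bigr => j _; rewrite big_ord1 !linearZ; congr (_ *: _).
  apply: (h (s 0 j)) => //.
  rewrite mulmxA DW -mulmxA scalemxAr; congr (_ *m _).
  apply/colP => i; rewrite mul_diag_mx !mxE.
  by case: eqP => [->|_]; rewrite // !mulr0.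
by rewrite -[c]mul1mx -WW' -mulmxA.
Qed.

End Matrices.

(** * Defect operators *)

Section Defects.
Variables (R : realType) (d : nat).
Implicit Types (A D M P : 'M[R[i]]_d) (c y : 'cV[R[i]]_d).

(** An operator acting as [D ^ 2] on the range of an isometry [W] and as 0 on
    its orthogonal complement has only one positive square root, because both
    summands are spanned by eigenvectors. *)
Lemma op_sqrtE (H : preHilbertType R) (W : 'cV[R[i]]_d -> H)
    (W' : H -> 'cV[R[i]]_d) D (A : H -> H) :
  adjoint W W' -> cancel W W' -> positive_mx D ->
  (forall x, A x = W (D *m D *m W' x)) -> op_sqrt A = fun x => W (D *m W' x).
Proof.
move=> adjW WK pD AE; have lW := adjoint_linear adjW.
have lW' := adjoint_linear (adjoint_sym adjW).
pose S0 (x : H) := W (D *m W' x).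
have S0P : [set S | positive_op S /\ forall x, S (S x) = A x] S0.
  split; last by move=> x; rewrite /S0 WK AE mulmxA.
  split=> [a x y|x]; first by rewrite /S0 lW' mulmxDr -scalemxAr lW.
  by rewrite adjW; exact: pD.2.
have : [set S | positive_op S /\ forall x, S (S x) = A x] (op_sqrt A).
  exact: (@xgetPex _ (fun=> 0) _ (ex_intro _ S0 S0P)).
move: (op_sqrt A) => S [pS SS]; apply/funext => x.
have lS := pS.1.
have SW : S \o W =1 fun c => W (D *m c).
  apply: (positive_mx_ext pD).
  - by move=> a u v /=; rewrite lW lS.
  - by move=> a u v; rewrite mulmxDr -scalemxAr lW.
  move=> s c s0 Dc /=; rewrite Dc (linear_scale _ _ lW).
  apply: (positive_op_eigen pS s0).
  by rewrite SS AE WK -mulmxA Dc -scalemxAr Dc scalerA (linear_scale _ _ lW).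
have S_ker : S (x - W (W' x)) = 0.
  rewrite -(scale0r (x - W (W' x))); apply: (positive_op_eigen pS) => //.
  rewrite SS AE (linear_sub _ _ lW') WK subrr mulmx0 (linear_zero lW).
  by rewrite expr0n scale0r.
rewrite -[in LHS](subrK (W (W' x)) x) (linear_add _ _ lS) S_ker add0r.
exact: SW.
Qed.

Definition mx_contraction A := forall c, hnorm (A *m c) <= hnorm c.

Lemma strict_contractionW A : strict_contraction A -> mx_contraction A.
Proof.
move=> sA c; have [->|c0] := eqVneq c 0; first by rewrite mulmx0.
exact/ltW/sA.
Qed.

(** Expanding the squared norm of [A A^* y - y] gives this substitute for the
    Cauchy-Schwarz inequality, by which [A^*] is a strict contraction whenever
    [A] is. *)
Lemma hnorm_adj_le A y :
  '[A^t* *m y, A^t* *m y] *+ 2 <=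
  '[A *m (A^t* *m y), A *m (A^t* *m y)] + '[y, y].
Proof.
rewrite -subr_ge0; set u := A^t* *m y.
have vy : '[A *m u, y] = '[u, u] by rewrite mulmx_adjoint.
have yv : '[y, A *m u] = '[u, u] by rewrite -(adjoint_sym (mulmx_adjoint A)).
rewrite [leRHS](_ : _ = '[A *m u - y, A *m u - y]); first exact: hdot_ge0.
by rewrite hdot_sub !linearBr /= vy yv; ring.
Qed.

Lemma strict_contraction_adj A :
  strict_contraction A -> strict_contraction (A^t*).
Proof.
move=> sA y y0; rewrite hnorm_ltE; have := hnorm_adj_le A y.
have [->|Ay0] := eqVneq (A^t* *m y) 0.
  by move=> _; rewrite linear0l; exact: hdot_gt0.
have := sA _ Ay0; rewrite hnorm_ltE => h1 h2.
rewrite -(ltrD2l '[A^t* *m y, A^t* *m y]) -mulr2n.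
by apply: (le_lt_trans h2); rewrite ltrD2r.
Qed.

Lemma mx_contraction_defect_ge0 A : mx_contraction A ->
  positive_mx (1%:M - A^t* *m A).
Proof.
move=> cA; split=> [|c]; first exact: mulmx_linear.
rewrite mulmxBl mul1mx hdot_sub -mulmxA (adjoint_sym (mulmx_adjoint A)).
by rewrite subr_ge0 -hnorm_leE.
Qed.

Lemma mx_defect_spec A : mx_contraction A ->
  positive_mx (mx_defect A) /\ mx_defect A *m mx_defect A = 1%:M - A^t* *m A.
Proof.
move=> /mx_contraction_defect_ge0/positive_mx_sqrt[D pD DD].
suff -> : mx_defect A = D by [].
apply: mx_of_opE => c; rewrite /defect (op_adjE (mulmx_adjoint A)).
rewrite (@op_sqrtE _ id id D)// => x.
by rewrite DD mulmxBl mul1mx mulmxA.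
Qed.

Lemma mx_defect_ge0 A : mx_contraction A -> positive_mx (mx_defect A).
Proof. by move=> /mx_defect_spec[]. Qed.

Lemma mx_defect_sqr A : mx_contraction A ->
  mx_defect A *m mx_defect A = 1%:M - A^t* *m A.
Proof. by move=> /mx_defect_spec[]. Qed.

Lemma mx_defect0 : mx_defect (0 : 'M[R[i]]_d) = 1%:M.
Proof.
apply: mx_of_opE => c; rewrite /defect (op_adjE (mulmx_adjoint 0)).
rewrite (@op_sqrtE _ id id 1%:M)//.
  split=> [|x]; first exact: mulmx_linear.
  by rewrite mul1mx hdot_ge0.
by move=> x; rewrite mul0mx mulmx0 subr0 !mul1mx.
Qed.

Lemma mx_defect_unit A : strict_contraction A -> mx_defect A \in unitmx.
Proof.
move=> sA; apply: unitmx_inj => c Dc0; apply/eqP/contraT => /sA.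
have : (mx_defect A *m mx_defect A) *m c = 0 by rewrite -mulmxA Dc0 mulmx0.
rewrite mx_defect_sqr; last exact: strict_contractionW.
rewrite mulmxBl mul1mx -mulmxA => /eqP; rewrite subr_eq0 => /eqP e.
have -> : hnorm (A *m c) = hnorm c; last by rewrite ltxx.
by congr (Num.sqrt (Re _)); rewrite [in RHS]e mulmx_adjoint -e.
Qed.

(** On an eigenvector [c] of the defect of [A] with eigenvalue [s], the square
    of the defect of [A^*] maps [A c] to [s ^+ 2 *: A c]. *)
Lemma mx_defect_intertwine A : mx_contraction A -> mx_contraction (A^t*) ->
  A *m mx_defect A = mx_defect (A^t*) *m A.
Proof.
move=> cA cA'; have pD := mx_defect_ge0 cA; have pD' := mx_defect_ge0 cA'.
apply: eq_mulmx; apply: (positive_mx_ext pD).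
- exact: mulmx_linear.
- exact: mulmx_linear.
move=> s c s0 Dc.
rewrite -[A *m _ *m c]mulmxA Dc -scalemxAr -[_ *m A *m c]mulmxA.
apply/esym/(positive_op_eigen pD' s0).
rewrite !mulmxA mx_defect_sqr// trmxCK !mulmxBl mul1mx -!mulmxA scalemxAr.
rewrite -mulmxBr; congr (_ *m _).
have -> : c - A^t* *m (A *m c) = (1%:M - A^t* *m A) *m c.
  by rewrite mulmxBl mul1mx mulmxA.
by rewrite -mx_defect_sqr// -mulmxA Dc -scalemxAr Dc scalerA.
Qed.

End Defects.

(** * The perturbed operator and its characteristic function *)

Section CharacteristicFunction.
Variables (R : realType) (H : preHilbertType R) (d : nat).
Variables (U U' : H -> H) (B : 'cV[R[i]]_d -> H) (B' : H -> 'cV[R[i]]_d).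
Hypotheses (adjU : adjoint U U') (UK : cancel U U') (U'K : cancel U' U).
Hypotheses (adjB : adjoint B B') (BK : cancel B B').
(* in a Hilbert space the Neumann series provides this *)
Hypothesis resolvent : forall z : R[i], `|z| < 1 ->
  forall y : H, exists x, x - z *: U' x = y.
Implicit Types (G : 'M[R[i]]_d) (x y : H) (c : 'cV[R[i]]_d) (z : R[i]).

Let linU : linear U := adjoint_linear adjU.
Let linU' : linear U' := adjoint_linear (adjoint_sym adjU).
Let linB : linear B := adjoint_linear adjB.
Let linB' : linear B' := adjoint_linear (adjoint_sym adjB).

Let BD c c' : B (c + c') = B c + B c'. Proof. exact: linear_add. Qed.
Let BN c c' : B (c - c') = B c - B c'. Proof. exact: linear_sub. Qed.
Let B'D x y : B' (x + y) = B' x + B' y. Proof. exact: linear_add. Qed.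
Let B'N x y : B' (x - y) = B' x - B' y. Proof. exact: linear_sub. Qed.
Let U'D x y : U' (x + y) = U' x + U' y. Proof. exact: linear_add. Qed.
Let U'N x y : U' (x - y) = U' x - U' y. Proof. exact: linear_sub. Qed.

Local Notation T := (perturbation U B).

Definition pert_adj G y := U' (y + B ((G^t* - 1%:M) *m B' y)).

Let TE G x : T G x = U x + B ((G - 1%:M) *m B' (U x)).
Proof. by rewrite /perturbation (op_adjE adjB). Qed.

Lemma pert_adjoint G : adjoint (T G) (pert_adj G).
Proof.
move=> x y; rewrite TE /pert_adj -adjU hdotDl hdotDr; congr (_ + _).
rewrite adjB mulmx_adjoint (adjoint_sym adjB); congr ('[_, B (_ *m _)]).
by rewrite linearB /= map_mxB trmx1 map_mx1.
Qed.

Let TTE G x : x - pert_adj G (T G x) = U' (B ((1%:M - G^t* *m G) *m B' (U x))).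
Proof.
rewrite TE /pert_adj B'D BK.
have -> : B' (U x) + (G - 1%:M) *m B' (U x) = G *m B' (U x).
  by rewrite mulmxBl mul1mx addrC subrK.
rewrite -{1}[x]UK -U'N; congr (U' _).
rewrite -addrA opprD addrA subrr add0r -BD -(sub0r (B _)).
rewrite -(linear_zero linB) -BN.
congr (B _); rewrite !mulmxBl !mul1mx mulmxA.
by rewrite [X in _ - X]addrC subrKA sub0r opprB.
Qed.

Let TT'E G y : y - T G (pert_adj G y) = B ((1%:M - G *m G^t*) *m B' y).
Proof.
rewrite TE /pert_adj U'K B'D BK.
have -> : B' y + (G^t* - 1%:M) *m B' y = G^t* *m B' y.
  by rewrite mulmxBl mul1mx addrC subrK.
rewrite -addrA opprD addrA subrr add0r -BD -(sub0r (B _)).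
rewrite -(linear_zero linB) -BN.
congr (B _); rewrite !mulmxBl !mul1mx mulmxA.
by rewrite [X in _ - X]addrC subrKA sub0r opprB.
Qed.

Lemma defect_pert G : mx_contraction G ->
  defect (T G) = fun x => U' (B (mx_defect G *m B' (U x))).
Proof.
move=> cG; rewrite /defect (op_adjE (pert_adjoint G)).
apply: (@op_sqrtE _ _ _ (U' \o B) (B' \o U)) => [||| x] /=.
- exact: adjoint_comp adjB (adjoint_sym adjU).
- by move=> c /=; rewrite U'K BK.
- exact: mx_defect_ge0.
- by rewrite TTE (mx_defect_sqr cG).
Qed.

Lemma defect_adj_pert G : mx_contraction (G^t*) ->
  defect_adj (T G) = fun y => B (mx_defect (G^t*) *m B' y).
Proof.
move=> cG; rewrite /defect_adj (op_adjE (pert_adjoint G)).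
apply: (op_sqrtE adjB BK) => [|y]; first exact: mx_defect_ge0.
by rewrite TT'E (mx_defect_sqr cG) (trmxCK G).
Qed.

Lemma pert_adj_le G y : mx_contraction (G^t*) ->
  '[pert_adj G y, pert_adj G y] <= '[y, y].
Proof.
move=> cG; rewrite -pert_adjoint -subr_ge0 -hdot_sub TT'E adjB.
by have := (mx_contraction_defect_ge0 cG).2 (B' y); rewrite trmxCK.
Qed.

Let linT' G : linear (pert_adj G).
Proof. exact: adjoint_linear (adjoint_sym (pert_adjoint G)). Qed.

Let linTz G z : linear (fun y => y - z *: pert_adj G y).
Proof.
move=> a x y; rewrite linT' scalerDr scalerBr opprD addrACA; congr (_ - _ + _).
by rewrite !scalerA mulrC.
Qed.

Let linUz z : linear (fun y => y - z *: U' y).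
Proof.
move=> a x y; rewrite linU' scalerDr scalerBr opprD addrACA; congr (_ - _ + _).
by rewrite !scalerA mulrC.
Qed.

Let U'_le y : '[U' y, U' y] <= '[y, y].
Proof. by rewrite -adjU U'K. Qed.

(** A fixed point of [z S] has norm at most [|z|] times its own norm. *)
Lemma resolvent_inj (S : H -> H) z : `|z| < 1 ->
  linear (fun y => y - z *: S y) -> (forall y, '[S y, S y] <= '[y, y]) ->
  injective (fun y => y - z *: S y).
Proof.
move=> z1 lS cS x y e; apply/eqP; rewrite -subr_eq0; apply/eqP.
have : (x - y) - z *: S (x - y) = 0 by rewrite (linear_sub _ _ lS) e subrr.
move: (x - y) => {e}w /eqP; rewrite subr_eq0 => /eqP e; apply: hdot_eq0.
have e2 : '[w, w] = `|z| ^+ 2 * '[S w, S w].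
  by rewrite {1 2}e hdotZl hdotZr mulrA -normCK.
apply/eqP; rewrite eq_le hdot_ge0 andbT.
have h : '[w, w] <= `|z| ^+ 2 * '[w, w].
  by rewrite {1}e2 ler_wpM2l// exprn_ge0.
rewrite -subr_le0 -[X in X - _]mul1r -mulrBl pmulr_rle0// in h.
by rewrite subr_gt0 expr_lt1.
Qed.

Lemma section_linear (V W : lmodType R[i]) (f : V -> W) (g : W -> V) :
  linear f -> injective f -> cancel g f -> linear g.
Proof. by move=> lf injf gK a x y; apply: injf; rewrite lf !gK. Qed.

(** [1 - z T^*] is a finite rank perturbation of [1 - z U^*], so inverting it
    amounts to solving a [d] by [d] system, whose matrix is invertible because
    [1 - z T^*] is injective. *)
Lemma pert_resolvent G z : mx_contraction (G^t*) -> `|z| < 1 ->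
  forall y, exists x, x - z *: pert_adj G x = y.
Proof.
move=> cG z1 y; have [r rK] := choice (resolvent z1).
have injU := resolvent_inj z1 (linUz z) U'_le.
have linr := section_linear (linUz z) injU rK.
(* [q \o B'] is the finite rank part of [pert_adj G] *)
pose q c := U' (B ((G^t* - 1%:M) *m c)).
have linq : linear q by move=> a u v; rewrite /q mulmxDr -scalemxAr linB linU'.
have TU x : x - z *: pert_adj G x = x - z *: U' x - z *: q (B' x).
  by rewrite /pert_adj U'D scalerDr opprD addrA.
pose k c := z *: r (q c).
have link : linear k.
  by move=> a u v; rewrite /k linq linr scalerDr !scalerA mulrC.
have kK c : k c - z *: U' (k c) = z *: q c.
  by rewrite /k (linear_scale _ _ (linUz z)) rK.
pose f c := c - B' (k c).
have linf : linear f.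
  move=> a u v; rewrite /f link linB' opprD addrACA scalerBr; congr (_ + _).
have fM c := mx_of_op_linear c linf.
have fU : mx_of_op f \in unitmx.
  apply: unitmx_inj => c; rewrite -fM => /eqP; rewrite subr_eq0 => /eqP ck.
  have k0 : k c = 0.
    have injT := resolvent_inj z1 (linTz G z) (fun y => pert_adj_le y cG).
    apply: injT; rewrite (linear_zero (linTz G z)) TU kK -ck subrr//.
  by rewrite ck k0 (linear_zero linB').
(* the value that [B' x] must have for the solution [x] *)
pose c := invmx (mx_of_op f) *m B' (r y).
have cE : c - B' (k c) = B' (r y) by rewrite -[LHS]/(f c) fM mulKVmx.
exists (r y + k c); rewrite TU (linear_add _ _ (linUz z)) rK kK B'D -cE subrK.
by rewrite addrK.
Qed.

Lemma op_inv_spec (S : H -> H) : injective S ->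
  (forall y, exists x, S x = y) -> cancel (op_inv S) S.
Proof.
move=> injS /choice[g gK].
have : [set A' | cancel S A' /\ cancel A' S] (op_inv S).
  apply: (@xgetPex _ (fun=> 0)); exists g; split=> // x.
  by apply: injS; rewrite gK.
by case.
Qed.

Local Notation theta := (char_theta U B).

(** Any solution of the resolvent equation computes the characteristic
    function, so the resolvent itself need not be carried around. *)
Lemma char_thetaE G z x c : mx_contraction G -> mx_contraction (G^t*) ->
  `|z| < 1 -> x - z *: pert_adj G x = U' (B (mx_defect G *m c)) ->
  theta G z *m c = z *: (mx_defect (G^t*) *m B' x) - G *m c.
Proof.
move=> cG cG' z1 xE; set D := mx_defect G; set D' := mx_defect _.
have injT := resolvent_inj z1 (linTz G z) (fun y => pert_adj_le y cG').
have invK := op_inv_spec injT (pert_resolvent cG' z1).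
set g := op_inv _ in invK.
have ling := section_linear (linTz G z) injT invK.
have gE : g (U' (B (D *m c))) = x by apply: injT; rewrite invK.
pose h (c : 'cV[R[i]]_d) := B' (g (U' (B (D *m c)))).
have linh : linear h.
  by move=> a u v; rewrite /h (mulmx_linear D) linB linU' ling linB'.
have hM := mx_of_op_linear _ linh.
suff -> : theta G z = z *: (D' *m mx_of_op h) - G.
  by rewrite mulmxBl -scalemxAl -mulmxA -hM /h gE.
apply: mx_of_opE => {xE gE}c /=; rewrite mulmxBl -scalemxAl -mulmxA -hM /h.
have adjV : adjoint (B' \o U) (U' \o B).
  exact: adjoint_comp adjU (adjoint_sym adjB).
rewrite (op_adjE adjB) (op_adjE adjV) (op_adjE (pert_adjoint G)) -/g /=.
rewrite defect_pert// defect_adj_pert// U'K BK -/D -/D' B'D.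
rewrite (linear_scale _ _ linB') BK addrC; congr (_ + _).
rewrite -sub0r B'N (linear_zero linB') sub0r TE U'K BK B'D !BK mulmxBl mul1mx.
by rewrite addrC subrK.
Qed.

Let contraction0 : mx_contraction (0 : 'M[R[i]]_d).
Proof. by move=> c; rewrite mul0mx hnorm_leE linear0l hdot_ge0. Qed.

Let contraction0' : mx_contraction ((0 : 'M[R[i]]_d)^t*).
Proof. by rewrite trmx0 map_mx0. Qed.

Lemma char_theta0E z x c : `|z| < 1 -> x - z *: pert_adj 0 x = U' (B c) ->
  theta 0 z *m c = z *: B' x.
Proof.
move=> z1 xE; rewrite (char_thetaE (x := x) contraction0 contraction0' z1).
  by rewrite trmx0 map_mx0 mx_defect0 mul1mx mul0mx subr0.
by rewrite mx_defect0 mul1mx.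
Qed.

(** For [x - z T_0^* x = U^* B c], the vector [U x] is the orthogonal sum of
    [z (x - B B^* x)] and [B c]; Pythagoras bounds [|z B^* x|] by [|c|]. *)
Lemma char_theta0_contraction z : `|z| < 1 -> mx_contraction (theta 0 z).
Proof.
move=> z1 c; have [x xE] := pert_resolvent contraction0' z1 (U' (B c)).
rewrite (char_theta0E z1 xE) hnorm_leE hdotZl hdotZr.
have {}xE : U x = z *: (x - B (B' x)) + B c.
  have -> : x - B (B' x) = U (pert_adj 0 x).
    rewrite /pert_adj U'K trmx0 map_mx0 mulmxBl mul0mx mul1mx sub0r.
    by rewrite -sub0r BN (linear_zero linB) sub0r.
  rewrite -(linear_scale _ _ linU) -[B c]U'K -xE -(linear_add _ _ linU).
  by rewrite addrC subrK.
have xx : '[x, x] = '[z *: (x - B (B' x)) + B c, z *: (x - B (B' x)) + B c].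
  by rewrite -xE adjU UK.
have BB' a : '[x - B (B' x), B a] = 0.
  by rewrite hdot_sub adjB BK -(adjoint_sym adjB) subrr.
have B'B a : '[B a, x - B (B' x)] = 0 by rewrite hdot_conj BB' conjC0.
have Pxx : '[x - B (B' x), x - B (B' x)] = '[x, x] - '[B' x, B' x].
  rewrite [LHS]hdot_sub B'B subr0 linearBr /=; congr (_ - _).
  by rewrite -(adjoint_sym adjB).
rewrite hdotDl !hdotDr !hdotZl !hdotZr BB' B'B Pxx in xx.
rewrite adjB BK !mulr0 addr0 add0r !mulrA -normCK mulrBr in xx.
rewrite mulrA -normCK -subr_ge0.
have -> : '[c, c] - `|z| ^+ 2 * '[B' x, B' x] = (1 - `|z| ^+ 2) * '[x, x].
  by rewrite mulrBl mul1r {1}xx; ring.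
by rewrite mulr_ge0 ?hdot_ge0// subr_ge0 expr_le1// ltW.
Qed.

(** One vector [x] serves for both characteristic functions: it solves the
    equation [x - z T_G^* x = U^* B D_G c], and also the equation of [T_0]
    once the term [z U^* B G^* B^* x] is moved to the right-hand side. *)
Lemma char_theta_mobius G z : mx_contraction G -> mx_contraction (G^t*) ->
  mx_defect (G^t*) \in unitmx -> `|z| < 1 ->
  (1%:M - theta 0 z *m G^t*) *m invmx (mx_defect (G^t*)) *m (theta G z + G)
    = theta 0 z *m mx_defect G.
Proof.
move=> cG cG' uD z1; apply: eq_mulmx => c.
have [x xE] := pert_resolvent cG' z1 (U' (B (mx_defect G *m c))).
have tc : (theta G z + G) *m c = mx_defect (G^t*) *m (z *: B' x).
  by rewrite mulmxDl (char_thetaE cG cG' z1 xE) subrK scalemxAr.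
rewrite -!mulmxA tc mulKmx// mulmxBl mul1mx -mulmxA.
apply/eqP; rewrite subr_eq -mulmxDr; apply/eqP/esym/char_theta0E => //.
have TG : pert_adj G x = pert_adj 0 x + U' (B (G^t* *m B' x)).
  rewrite /pert_adj -U'D -addrA -BD trmx0 map_mx0 -mulmxDl sub0r.
  by rewrite [- _ + _]addrC.
rewrite BD U'D -xE TG scalerDr opprD addrA -scalemxAr (linear_scale _ _ linB).
by rewrite (linear_scale _ _ linU') subrK.
Qed.

End CharacteristicFunction.

(** * Multiplication operators on the direct integral *)

Section Multiplication.
Local Open Scope quotient_scope.
Variables (R : realType) (mu : {measure set (torus R) -> \bar R}).
Variables (E : hilbertType R) (eps : onb E) (N : torus R -> option nat).
Local Notation H := (dintegral mu eps N).
Implicit Types (x y : H) (u v : dint_rep mu eps N) (z : R[i]).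

Definition bounded_symbol (phi : torus R -> R[i]) :=
  [/\ measurable_fun [set: torus R] (fun xi => Re (phi xi)),
      measurable_fun [set: torus R] (fun xi => Im (phi xi)) &
      exists C : R, forall xi, Re (phi xi) ^+ 2 + Im (phi xi) ^+ 2 <= C].

Lemma mul_dint_fun phi u : bounded_symbol phi ->
  (fun xi => phi xi *: u xi) \in dint_fun mu eps N.
Proof.
move=> [mr mi [C phiC]].
have [mu_ iu fu] : [/\ weakly_measurable u, mu.-integrable [set: torus R]
    (fun xi => (hnorm (u xi) ^+ 2)%:E) &
    {ae mu, forall xi, fiber eps N xi (u xi)}].
  by case: u => u /= /asboolP.
apply/asboolP; split.
- move=> e; have [m1 m2] := mu_ e; split.
    rewrite (_ : (fun _ => _) = fun xi =>
      Re (phi xi) * Re '[u xi, e] - Im (phi xi) * Im '[u xi, e]).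
      by apply: measurable_funB; apply: measurable_funM.
    by apply/funext => xi; rewrite hdotZl; case: (phi xi) '[_, _] => ? ? [].
  rewrite (_ : (fun _ => _) = fun xi =>
    Re (phi xi) * Im '[u xi, e] + Im (phi xi) * Re '[u xi, e]).
    by apply: measurable_funD; apply: measurable_funM.
  by apply/funext => xi; rewrite hdotZl; case: (phi xi) '[_, _] => ? ? [].
- have := integrableZl measurableT C iu; apply: le_integrable => //.
    rewrite (_ : (fun _ => _) = (fun xi =>
      ((Re (phi xi) ^+ 2 + Im (phi xi) ^+ 2) * hnorm (u xi) ^+ 2)%:E)).
      apply/measurable_EFinP/measurable_funM.
        by apply: measurable_funD; apply: measurable_funX.
      by apply/measurable_EFinP; exact: measurable_int iu.
    by apply/funext => xi; rewrite hnorm_sqrZ.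
  move=> xi _ /=; rewrite lee_fin !ger0_norm ?sqr_ge0//.
    by rewrite hnorm_sqrZ ler_wpM2r// sqr_ge0.
  by rewrite mulr_ge0 ?sqr_ge0// (le_trans _ (phiC xi))// addr_ge0 ?sqr_ge0.
- apply: filterS fu => xi uxi; rewrite -[_ *: _]addr0.
  by apply: hclosure_span_lin => //; exact: hclosure_span0.
Qed.

Definition dint_mul phi (h : bounded_symbol phi) x : H :=
  \pi_(H) (DintRep (mul_dint_fun (repr x) h)).

Lemma dint_ae_eq x y : {ae mu, forall xi, repr x xi = repr y xi} -> x = y.
Proof. by move=> h; rewrite -[x]reprK -[y]reprK; apply/dint_pi_eq. Qed.

Lemma repr_mul phi (h : bounded_symbol phi) x :
  {ae mu, forall xi, repr (dint_mul h x) xi = phi xi *: repr x xi}.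
Proof. exact: dint_reprK. Qed.

Lemma repr_Mxi x :
  {ae mu, forall xi, repr (Mxi x) xi = sval xi *: repr x xi}.
Proof. exact: dint_reprK. Qed.

Lemma repr_subZ z x y :
  {ae mu, forall xi, repr (x - z *: y) xi = repr x xi - z *: repr y xi}.
Proof.
have := dint_reprK (repr x - z *: repr y).
have -> : x - z *: y = \pi_(H) (repr x - z *: repr y).
  by rewrite -scaleNr -[- (z *: repr y)]scaleNr dint_piD dint_piZ !reprK.
by [].
Qed.

Lemma circle_mul_conj (xi : torus R) : sval xi * Num.conj (sval xi) = 1.
Proof. by rewrite -normCK (eqP (svalP xi)) expr1n. Qed.

Lemma circle_sqr (xi : torus R) : Re (sval xi) ^+ 2 + Im (sval xi) ^+ 2 = 1.
Proof.
have := congr1 (@complex.Re R) (circle_mul_conj xi).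
by case: (sval xi) => a b /=; rewrite mulrN opprK !expr2.
Qed.

Lemma conj_bounded_symbol : bounded_symbol (fun xi => Num.conj (sval xi)).
Proof.
split.
- rewrite (_ : (fun _ => _) = fun xi : torus R => Re (sval xi)).
    exact: torus_Re.
  by apply/funext => xi; rewrite conjRe.
- rewrite (_ : (fun _ => _) = fun xi : torus R => - Im (sval xi)).
    by apply: measurableT_comp => //; exact: torus_Im.
  by apply/funext => xi; rewrite conjIm.
- by exists 1 => xi; rewrite conjRe conjIm sqrrN circle_sqr.
Qed.

Definition Mxi_adj := dint_mul conj_bounded_symbol.

Lemma Mxi_adjoint : adjoint (@Mxi R mu E eps N) Mxi_adj.
Proof.
move=> x y; rewrite -[y in LHS]reprK -[x in RHS]reprK /Mxi /Mxi_adj /dint_mul.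
rewrite [LHS]dint_dot_pi [RHS]dint_dot_pi; congr cintegral.
by apply/funext => xi /=; rewrite hdotZl hdotZr conjCK.
Qed.

Lemma MxiK : cancel (@Mxi R mu E eps N) Mxi_adj.
Proof.
move=> x; apply: dint_ae_eq.
apply: filterS2 (repr_mul conj_bounded_symbol (Mxi x)) (repr_Mxi x) => xi -> ->.
by rewrite scalerA mulrC circle_mul_conj scale1r.
Qed.

Lemma Mxi_adjK : cancel Mxi_adj (@Mxi R mu E eps N).
Proof.
move=> x; apply: dint_ae_eq.
apply: filterS2 (repr_Mxi (Mxi_adj x)) (repr_mul conj_bounded_symbol x).
move=> xi -> ->.
by rewrite scalerA circle_mul_conj scale1r.
Qed.

(** [1 - z conj xi] stays at distance at least [1 - |z|] from 0. *)
Lemma resolvent_lower_bound z : `|z| < 1 -> exists2 e : R, 0 < e &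
  forall xi : torus R, e <= Re (1 - z * Num.conj (sval xi)) ^+ 2 +
                            Im (1 - z * Num.conj (sval xi)) ^+ 2.
Proof.
rewrite normc_def -[X in _ < X]/(1%:C) ltcR; set s := Num.sqrt _ => s1.
exists ((1 - s) ^+ 2) => [|xi]; first by rewrite exprn_gt0// subr_gt0.
set w := 1 - z * _.
have : 1 - `|z| <= `|w|.
  have -> : `|z| = `|z * Num.conj (sval xi)|.
    by rewrite normrM norm_conjC (eqP (svalP xi)) mulr1.
  by rewrite -[X in X - _](normr1 R[i]) lerB_dist.
rewrite !normc_def -/s -[X in X - _ <= _]/(1%:C) -rmorphB /= lecR => h.
rewrite -[leRHS]sqr_sqrtr ?addr_ge0 ?sqr_ge0// ler_pXn2r// nnegrE ?sqrtr_ge0//.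
by rewrite subr_ge0 ltW.
Qed.

Lemma resolvent_bounded_symbol z : `|z| < 1 ->
  bounded_symbol (fun xi => (1 - z * Num.conj (sval xi))^-1).
Proof.
move=> /resolvent_lower_bound[e e0 he].
pose w (xi : torus R) := 1 - z * Num.conj (sval xi).
pose a (xi : torus R) := 1 - (Re z * Re (sval xi) + Im z * Im (sval xi)).
pose b (xi : torus R) := Re z * Im (sval xi) - Im z * Re (sval xi).
have wE xi : w xi = a xi +i* b xi.
  by rewrite /w /a /b; case: (sval xi) => p q; case: z {he w a b} => r s;
    apply/eqP; rewrite eq_complex /=; apply/andP; split; apply/eqP; ring.
have mRe := @torus_Re R; have mIm := @torus_Im R.
have ma : measurable_fun setT a.
  by apply: measurable_funB => //; apply: measurable_funD;
    apply: measurable_funM.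
have mb : measurable_fun setT b.
  by apply: measurable_funB; apply: measurable_funM.
pose q xi := a xi ^+ 2 + b xi ^+ 2.
have qe xi : e <= q xi by have := he xi; rewrite -/(w xi) wE.
have q0 xi : 0 < q xi := lt_le_trans e0 (qe xi).
have mq : measurable_fun setT (fun xi => (q xi)^-1).
  rewrite (_ : (fun _ => _) = (@powR R ^~ (-1)) \o q).
    apply: measurableT_comp; first exact: measurable_powR.
    by apply: measurable_funD; apply: measurable_funX.
  by apply/funext => xi /=; rewrite powR_inv1// ltW.
have wV xi : (w xi)^-1 = (a xi / q xi) +i* (- (b xi / q xi)) by rewrite wE.
split.
- rewrite (_ : (fun _ => _) = fun xi => a xi / q xi).
    exact: measurable_funM.
  by apply/funext => xi; rewrite -/(w xi) wV.
- rewrite (_ : (fun _ => _) = fun xi => - (b xi / q xi)).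
    by apply: measurableT_comp => //; exact: measurable_funM.
  by apply/funext => xi; rewrite -/(w xi) wV.
- exists e^-1 => xi; rewrite -/(w xi) wV /=.
  have -> : (a xi / q xi) ^+ 2 + (- (b xi / q xi)) ^+ 2 = (q xi)^-1.
    rewrite sqrrN !expr_div_n -mulrDl -/(q xi) [q xi ^+ 2]expr2.
    by rewrite invfM mulrA divff ?mul1r// gt_eqF.
  by rewrite lef_pV2 ?posrE.
Qed.

Lemma Mxi_resolvent z : `|z| < 1 ->
  forall y : H, exists x, x - z *: Mxi_adj x = y.
Proof.
move=> z1 y; have h := resolvent_bounded_symbol z1; exists (dint_mul h y).
set x := dint_mul h y; apply: dint_ae_eq.
apply: filterS3 (repr_subZ z x (Mxi_adj x)) (repr_mul conj_bounded_symbol x)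
  (repr_mul h y) => xi -> ->; rewrite -/x => ->.
rewrite !scalerA -scalerBl -[X in X - _]mul1r -mulrBl divff ?scale1r//.
have [e e0 /(_ xi)/=] := resolvent_lower_bound z1.
by apply: contraTneq => ->; rewrite /= expr0n addr0 -ltNge.
Qed.

End Multiplication.

(** * Entrywise limits and nontangential limits *)

Section Limits.
Variables (K : numFieldType) (T : Type) (F : set_system T).
Hypothesis FF : ProperFilter F.

Definition entrywise_cvg m n (f : T -> 'M[K]_(m, n)) (A : 'M[K]_(m, n)) :=
  forall i j, f z i j @[z --> F] --> A i j.

Lemma entrywise_cvg_cst m n (A : 'M[K]_(m, n)) : entrywise_cvg (fun=> A) A.
Proof. by move=> i j; exact: cvg_cst. Qed.

Lemma entrywise_cvgD m n (f g : T -> 'M[K]_(m, n)) A B :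
  entrywise_cvg f A -> entrywise_cvg g B ->
  entrywise_cvg (fun z => f z + g z) (A + B).
Proof.
move=> fA gB i j; rewrite mxE; under eq_fun do rewrite mxE.
by apply: cvgD; [exact: fA|exact: gB].
Qed.

Lemma entrywise_cvgB m n (f g : T -> 'M[K]_(m, n)) A B :
  entrywise_cvg f A -> entrywise_cvg g B ->
  entrywise_cvg (fun z => f z - g z) (A - B).
Proof.
move=> fA gB i j; rewrite !mxE; under eq_fun do rewrite !mxE.
by apply: cvgB; [exact: fA|exact: gB].
Qed.

Lemma cvg_sum_seq (I : Type) (r : seq I) (f : I -> T -> K) (a : I -> K) :
  (forall i, f i z @[z --> F] --> a i) ->
  (\sum_(i <- r) f i z) @[z --> F] --> \sum_(i <- r) a i.
Proof.
move=> h; elim: r => [|i r IH].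
  by rewrite big_nil; under eq_fun do rewrite big_nil; exact: cvg_cst.
by rewrite big_cons; under eq_fun do rewrite big_cons; apply: cvgD.
Qed.

Lemma entrywise_cvgM m n p (f : T -> 'M[K]_(m, n)) (g : T -> 'M[K]_(n, p)) A B :
  entrywise_cvg f A -> entrywise_cvg g B ->
  entrywise_cvg (fun z => f z *m g z) (A *m B).
Proof.
move=> fA gB i j; rewrite mxE; under eq_fun do rewrite mxE.
by apply: cvg_sum_seq => k; apply: cvgM; [exact: fA|exact: gB].
Qed.

Lemma entrywise_cvg_eq m n (f g : T -> 'M[K]_(m, n)) A B :
  entrywise_cvg f A -> entrywise_cvg g B -> (\forall z \near F, f z = g z) ->
  A = B.
Proof.
move=> fA gB fg; apply/matrixP => i j.
have gA : g z i j @[z --> F] --> A i j.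
  apply: cvg_trans (fA i j); apply: near_eq_cvg.
  by apply: filterS fg => z ->.
exact: (cvg_unique (@norm_hausdorff _ _) gA (gB i j)).
Qed.

Lemma entrywise_cvg_norm_le m n p (f : T -> 'M[K]_(m, n)) A (x : 'cV[K]_n)
    (y : 'cV[K]_p) :
  entrywise_cvg f A ->
  (\forall z \near F, \sum_i `|(f z *m x) i 0| ^+ 2 <= \sum_i `|y i 0| ^+ 2) ->
  \sum_i `|(A *m x) i 0| ^+ 2 <= \sum_i `|y i 0| ^+ 2.
Proof.
move=> fA le; set S := (X in _ <= X) in le *; set L := (X in X <= _).
have sum_real q (v : 'cV[K]_q) : \sum_i `|v i 0| ^+ 2 \is Num.real.
  by rewrite ger0_real// sumr_ge0// => i _; rewrite exprn_ge0.
have fc := entrywise_cvgM fA (@entrywise_cvg_cst _ _ x).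
have lim : (\sum_i `|(f z *m x) i 0| ^+ 2) @[z --> F] --> L.
  by apply: cvg_sum_seq => i; rewrite expr2; under eq_fun do rewrite expr2;
    apply: cvgM; apply: cvg_norm; exact: fc.
rewrite real_leNgt ?sum_real//; apply/negP => lt.
have e0 : 0 < L - S by rewrite subr_gt0.
move/cvgrPdist_lt: lim => /(_ _ e0) near1.
have [z [h1 h2]] := filter_ex (filterI near1 le).
have := le_lt_trans (real_ler_norm (rpredB (sum_real _ _) (sum_real _ _))) h1.
by rewrite ltrD2l ltrN2 => /lt_le_trans/(_ h2); rewrite ltxx.
Qed.

End Limits.

Section BoundaryValues.
Variable R : realType.
Local Notation K := (R[i] : numFieldType).

(** Stolz regions contain the radius ending at [xi], hence accumulate there:
    this makes nontangential limits unique. *)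
Lemma stolz_proper (xi : torus R) (a : R) : 1 < a ->
  ProperFilter (within (stolz a xi) (nbhs (sval xi : K))).
Proof.
move=> a1; apply: Build_ProperFilter_ex => A.
rewrite /within /= => /nbhs_ballP[e /= e0 eA].
have [r r0 re] : exists2 r : R, 0 < r & r%:C < e.
  move: e0; case: (e) => p q; rewrite ltcE /= => /andP[/eqP-> p0].
  by exists (p / 2); rewrite ?ltcE /= ?eqxx; lra.
pose t := Num.min r 2^-1.
have t0 : 0 < t by rewrite lt_min r0 invr_gt0 ltr0n.
have t1 : 0 < 1 - t by rewrite subr_gt0 gt_min [2^-1 < 1]invf_lt1 ?ltr1n ?orbT.
pose z : R[i] := (1 - t)%:C * sval xi.
have zE : sval xi - z = t%:C * sval xi.
  by rewrite /z rmorphB /= mulrBl mul1r opprB addrC subrK.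
have norm_real (s : R) : 0 < s -> `|s%:C * sval xi| = s%:C.
  by move=> s0; rewrite normrM (eqP (svalP xi)) mulr1 ger0_norm// lecR ltW.
exists z; apply: (eA z).
  rewrite /ball_ /= zE norm_real//; apply: le_lt_trans re.
  by rewrite lecR ge_min lexx.
split; first by rewrite norm_real// ltcR gtrBl.
rewrite -normrN opprB zE !norm_real// -rmorphB subKr -rmorphM /= ltcR.
by rewrite ltr_pMl.
Qed.

Lemma nontangential_entrywise d (theta : R[i] -> 'M[R[i]]_d) xi A :
  nontangential_limit theta xi A ->
  @entrywise_cvg K _ (within (stolz 2 xi) (nbhs (sval xi : K))) _ _ theta A.
Proof.
move=> h i j; have h2 := h 2 (ltr1n _ 2).
exact: (cvg_comp _ (fun M : 'M[K]_d => M i j) h2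
  (@coord_continuous K d d i j A)).
Qed.

Lemma entrywise_cvg_contraction d (F : set_system R[i])
    (f : R[i] -> 'M[R[i]]_d) A :
  ProperFilter F -> @entrywise_cvg K _ F _ _ f A ->
  (\forall z \near F, mx_contraction (f z)) -> mx_contraction A.
Proof.
move=> FF fA cf c; rewrite hnorm_leE.
have dotE (x : 'cV[R[i]]_d) : '[x, x] = \sum_i `|x i 0| ^+ 2.
  by apply: eq_bigr => i _; rewrite normCK.
rewrite !dotE; apply: (@entrywise_cvg_norm_le K _ _ FF _ _ _ f A c c fA).
by apply: filterS cf => z /(_ c); rewrite hnorm_leE !dotE.
Qed.

End BoundaryValues.

(** * The defect of a Moebius transform *)

Section DefectIdentity.
Variables (R : realType) (d : nat).
Implicit Types (A G S T : 'M[R[i]]_d) (c : 'cV[R[i]]_d).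

Lemma adjmxM A G : (A *m G)^t* = G^t* *m A^t*.
Proof. by rewrite trmx_mul map_mxM. Qed.

Lemma adjmxB A G : (A - G)^t* = A^t* - G^t*.
Proof. by rewrite linearB /= map_mxB. Qed.

Lemma adjmx1 : (1%:M : 'M[R[i]]_d)^t* = 1%:M.
Proof. by rewrite trmx1 map_mx1. Qed.

Lemma adjmx_inv A : (invmx A)^t* = invmx (A^t*).
Proof. by rewrite trmx_inv map_invmx. Qed.

Lemma unitmx_sub_adj G S : strict_contraction G -> mx_contraction S ->
  1%:M - G^t* *m S \in unitmx.
Proof.
move=> /strict_contraction_adj sG ct; apply: unitmx_inj => c.
rewrite mulmxBl mul1mx -mulmxA => /eqP; rewrite subr_eq0 => /eqP e.
apply/eqP/contraT => c0; have tc0 : S *m c != 0.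
  by apply: contraNneq c0 => tc; rewrite e tc mulmx0.
by have := lt_le_trans (sG _ tc0) (ct c); rewrite -e ltxx.
Qed.

Lemma unitmx_sub_mul_adj G S : strict_contraction G -> mx_contraction S ->
  1%:M - S *m G^t* \in unitmx.
Proof.
move=> /strict_contraction_adj sG ct; apply: unitmx_inj => c.
rewrite mulmxBl mul1mx -mulmxA => /eqP; rewrite subr_eq0 => /eqP e.
apply/eqP/contraT => c0.
by have := le_lt_trans (ct (G^t* *m c)) (sG _ c0); rewrite -e ltxx.
Qed.

(** Primes denote adjoints, [D] is the defect of [G] and [E] that of [G']. With
    [L = (1 - G' S)^-1] and [a = S L], the hypothesis solves to
    [T = E a D - G], and [L = 1 + G' a]. Substituting [E ^ 2 = 1 - G G'] and
    [E G = G D], the expansion of [1 - T' T] becomes [D (L' L - a' a) D]. *)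
Lemma mobius_defect G S T : strict_contraction G -> mx_contraction S ->
  (1%:M - S *m G^t*) *m invmx (mx_defect (G^t*)) *m (T + G)
    = S *m mx_defect G ->
  1%:M - T^t* *m T =
    mx_defect G *m invmx (1%:M - S^t* *m G) *m (1%:M - S^t* *m S)
      *m invmx (1%:M - G^t* *m S) *m mx_defect G.
Proof.
move=> sG ct e; have sG' := strict_contraction_adj sG.
have cG := strict_contractionW sG; have cG' := strict_contractionW sG'.
have DD := mx_defect_sqr cG; have D'D' := mx_defect_sqr cG'.
have hD := positive_mx_hermitian (mx_defect_ge0 cG).
have hD' := positive_mx_hermitian (mx_defect_ge0 cG').
have GD := mx_defect_intertwine cG cG'.
have uD' := mx_defect_unit sG'; have uL := unitmx_sub_adj sG ct.
have uL' := unitmx_sub_mul_adj sG ct.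
rewrite trmxCK in D'D'.
move: (mx_defect G) (mx_defect (G^t*)) DD D'D' hD hD' GD uD' e =>
  D D' DD D'D' hD hD' GD uD' e.
have DG : G^t* *m D' = D *m G^t*.
  by rewrite -hD' -adjmxM -GD adjmxM hD.
have -> : 1%:M - S^t* *m G = (1%:M - G^t* *m S)^t*.
  by rewrite adjmxB adjmx1 adjmxM (trmxCK G); congr (_ - _).
rewrite -adjmx_inv; set L := invmx _.
have [a aSL] : exists a, a = S *m L by exists (S *m L).
have L1 : L = 1%:M + G^t* *m a.
  apply/eqP; rewrite -subr_eq aSL mulmxA -[X in X - _]mul1mx -mulmxBl.
  by rewrite (mulmxV uL).
have L1' : L^t* = 1%:M + a^t* *m G.
  by rewrite L1 linearD /= map_mxD adjmx1 adjmxM (trmxCK G).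
have aE : (1%:M - S *m G^t*) *m a = S.
  by rewrite mulmxBl mul1mx -mulmxA {1}aSL -mulmxBr L1 addrK mulmx1.
have tGE : T = D' *m (a *m D) - G.
  apply/eqP; rewrite eq_sym subr_eq eq_sym; apply/eqP.
  rewrite -(mulKVmx uD' (T + G)); congr (_ *m _).
  rewrite -[LHS](mulKmx uL') -[RHS](mulKmx uL'); congr (_ *m _).
  by rewrite mulmxA e mulmxA aE.
have tGE' : T^t* = D *m (a^t* *m D') - G^t*.
  by rewrite tGE adjmxB adjmxM hD' adjmxM hD mulmxA.
have D'Dc (x : 'M[R[i]]_d) : D' *m (D' *m x) = x - G *m (G^t* *m x).
  by rewrite mulmxA D'D' mulmxBl mul1mx mulmxA.
have -> : D *m L^t* *m (1%:M - S^t* *m S) *m L *m D =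
    D *m (L^t* *m (L *m D) - a^t* *m (a *m D)).
  rewrite aSL adjmxM -!mulmxA -mulmxBr mulmxBl mul1mx -mulmxA.
  by congr (_ *m (_ *m (_ - _))).
have -> : T^t* *m T = D *m (a^t* *m (a *m D - G *m (G^t* *m (a *m D))))
    - D *m (a^t* *m (G *m D)) - (D *m (G^t* *m (a *m D)) - G^t* *m G).
  rewrite tGE' tGE mulmxBl !mulmxBr -!mulmxA -GD D'Dc.
  by rewrite [G^t* *m (D' *m _)]mulmxA DG -mulmxA !mulmxBr.
rewrite !mulmxBr L1' L1 !mulmxDl !mulmxDr !mul1mx -!mulmxA DD.
move: (D *m (a^t* *m (G *m (G^t* *m (a *m D))))) (D *m (a^t* *m (a *m D)))
  (D *m (a^t* *m (G *m D))) (D *m (G^t* *m (a *m D))) (G^t* *m G) =>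
  X1 X2 X3 X4 X5.
(* entrywise, what remains is a linear identity between the five products *)
by apply/matrixP => i j; rewrite !mxE; ring.
Qed.

(** The right-hand side of [mobius_defect] is positive, so [T] is a contraction
    and its defect squares to [1 - T^* T]. *)
Lemma mobius_defect_sqr G S T : strict_contraction G -> mx_contraction S ->
  (1%:M - S *m G^t*) *m invmx (mx_defect (G^t*)) *m (T + G)
    = S *m mx_defect G ->
  mx_defect T *m mx_defect T =
    mx_defect G *m invmx (1%:M - S^t* *m G) *m (mx_defect S *m mx_defect S)
      *m invmx (1%:M - G^t* *m S) *m mx_defect G.
Proof.
move=> sG ct e; have E := mobius_defect sG ct e.
rewrite (mx_defect_sqr ct) -E mx_defect_sqr// => c.
have hD := positive_mx_hermitian (mx_defect_ge0 (strict_contractionW sG)).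
rewrite hnorm_leE -subr_ge0.
have -> : '[c, c] - '[T *m c, T *m c] = '[(1%:M - T^t* *m T) *m c, c].
  by rewrite mulmxBl mul1mx hdot_sub -mulmxA (adjoint_sym (mulmx_adjoint T)).
set L := invmx (1%:M - G^t* *m S) in E.
have EL : invmx (1%:M - S^t* *m G) = L^t*.
  rewrite /L adjmx_inv adjmxB adjmx1 adjmxM (trmxCK G).
  by congr (invmx (_ - _)).
rewrite E EL -!mulmxA -{1}hD (adjoint_sym (mulmx_adjoint _)).
by rewrite (adjoint_sym (mulmx_adjoint L)) (mx_contraction_defect_ge0 ct).2.
Qed.

End DefectIdentity.

(** * The defect functions of the perturbations *)

(** The domain being finite-dimensional, the adjoint is given by coordinates;
    polarization turns preservation of norms into [B' (B c) = c]. *)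
Lemma isometry_adjoint (R : realType) (H : preHilbertType R) (d : nat)
    (B : {linear 'cV[R[i]]_d -> H}) : isometric B ->
  exists2 B', adjoint B B' & cancel B B'.
Proof.
move=> isoB; pose B' h : 'cV[R[i]]_d := \col_i '[h, B (delta_mx i 0)].
have adjB : adjoint B B'.
  move=> x h; rewrite {1}[x]matrix_sum_delta linear_sum hdot_suml.
  rewrite cdotE; apply: eq_bigr => i _.
  by rewrite big_ord1 linearZ hdotZl /B' !mxE -hdot_conj.
exists B' => // c; apply: hdot_inj => z; rewrite -adjB.
have BRe x y : Re '[B x, B y] = Re '[x, y].
  by rewrite !Re_hdot_polar -linearD !isoB.
apply/eqP; rewrite eq_complex BRe eqxx /=.
by rewrite !Im_hdot -linearZ BRe.
Qed.

Lemma ae_circle_and (R : realType) (P Q S : torus R -> Prop) :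
  ae_circle P -> ae_circle Q -> (forall xi, P xi -> Q xi -> S xi) ->
  ae_circle S.
Proof.
move=> aeP aeQ PQS; have F := ae_filter_ringOfSetsType (@lebesgue_measure R).
by apply: (@filterS2 _ _ F _ _ _ _ aeP aeQ) => t; exact: PQS.
Qed.

Theorem theorem5p5 (R : realType)
    (mu : {finite_measure set (torus R) -> \bar R})
    (E : hilbertType R) (eps : onb E)
    (N : torus R -> option nat)
    (measN : forall k : option nat, measurable [set xi | N xi = k])
    (d : nat) (B : {linear 'cV[R[i]]_d -> dintegral mu eps N})
    (isoB : isometric B)
    (G : 'M[R[i]]_d) (sG : strict_contraction G)
    (theta0 thetaG : torus R -> 'M[R[i]]_d)
    (btheta0 : boundary_values (char_theta (@Mxi R mu E eps N) B 0) theta0)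
    (bthetaG : boundary_values (char_theta (@Mxi R mu E eps N) B G) thetaG) :
  ae_circle (fun xi =>
    mx_defect (thetaG xi) *m mx_defect (thetaG xi) =
    mx_defect G *m invmx (1%:M - (theta0 xi)^t* *m G)
      *m (mx_defect (theta0 xi) *m mx_defect (theta0 xi))
      *m invmx (1%:M - G^t* *m theta0 xi) *m mx_defect G).
Proof.
have [B' adjB BK] := isometry_adjoint isoB.
have adjU := @Mxi_adjoint R mu E eps N.
have UK := @MxiK R mu E eps N; have U'K := @Mxi_adjK R mu E eps N.
have res := @Mxi_resolvent R mu E eps N.
have sG' := strict_contraction_adj sG.
have ae0 : ae_circle (fun xi => nontangential_limit _ xi (theta0 xi)) :=
  btheta0.
have aeG : ae_circle (fun xi => nontangential_limit _ xi (thetaG xi)) :=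
  bthetaG.
apply: (ae_circle_and ae0 aeG) => xi lim0 limG.
have FF : ProperFilter
    (within (stolz 2 xi) (nbhs (sval xi : (R[i] : numFieldType)))).
  by apply: stolz_proper; rewrite ltr1n.
have cvg0 := nontangential_entrywise lim0.
have cvgG := nontangential_entrywise limG.
have ct : mx_contraction (theta0 xi).
  apply: (entrywise_cvg_contraction FF cvg0); rewrite near_withinE.
  apply: nearW => z [z1 _].
  exact: (char_theta0_contraction adjU UK U'K adjB BK res z1).
apply: mobius_defect_sqr => //.
have cst A := @entrywise_cvg_cst (R[i] : numFieldType) _ _ FF d d A.
apply: (entrywise_cvg_eq FF
  (entrywise_cvgM FF (entrywise_cvgM FF
    (entrywise_cvgB FF (cst 1%:M) (entrywise_cvgM FF cvg0 (cst (G^t*))))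
    (cst (invmx (mx_defect (G^t*))))) (entrywise_cvgD FF cvgG (cst G)))
  (entrywise_cvgM FF cvg0 (cst (mx_defect G)))).
rewrite near_withinE; apply: nearW => z [z1 _].
apply: (char_theta_mobius adjU UK U'K adjB BK res) => //.
- exact: strict_contractionW.
- exact: strict_contractionW.
- exact: mx_defect_unit.
Qed.
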